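(* Let $g\in\mathscr{L}$, let $\mathbb{A}=(A_1,\ldots,A_n)$ be an $n$-tuple of positive definite matrices in $\mathcal{M}_k$ with $mI\le A_i\le MI$ $(i=1,\ldots,n)$ for some scalars $0<m<M$, and let $w=(w_1,\ldots,w_n)$ be a weight vector. Put $h=\frac{M}{m}$. Then, for every unital positive linear map $\Phi:\mathcal{M}_k\to\mathcal{M}_{l}$, $$\Phi\left(\sigma_g(w;\mathbb{A})\right)\le \sigma_g\left(w;\Phi(\mathbb{A})\right)\le K(h,2)\,\Phi\left(\sigma_g(w;\mathbb{A})\right),$$ where $\Phi(\mathbb{A})=(\Phi(A_1),\ldots,\Phi(A_n))$.
   Context: $\mathcal{M}_k$ is the algebra of complex $k\times k$ matrices, $I$ the identity matrix, and $A\le B$ for Hermitian matrices means $B-A$ is positive semidefinite. A weight vector is $w=(w_1,\ldots,w_n)$ with all $w_i>0$ and $\sum_{i=1}^n w_i=1$. $\mathscr{L}$ is the set of all operator monotone functions $g$ on $(0,\infty)$ (real-valued functions, applied to positive definite matrices by functional calculus, with $A\le B\Rightarrow g(A)\le g(B)$ for positive definite matrices of every size) satisfying $g(1)=0$ and $g'(1)=1$. For $g\in\mathscr{L}$, a weight vector $w$ and positive definite $\mathbb{A}=(A_1,\ldots,A_n)$, $\sigma_g(w;\mathbb{A})$ denotes the (unique) positive definite solution $X$ of the generalized Karcher equation $\sum_{i=1}^{n}w_i\,g\left(X^{-1/2}A_iX^{-1/2}\right)=0$. The Kantorovich constant is $K(h,2)=\frac{(h+1)^2}{4h}$. A linear map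 $\Phi:\mathcal{M}_{k}\to\mathcal{M}_{l}$ is positive if $A\ge 0$ implies $\Phi(A)\ge0$, and unital if $\Phi(I_{k})=I_{l}$. *)

(* Defs.v *)
From mathcomp Require Import all_boot all_order all_algebra.
From mathcomp Require Import complex.
From mathcomp Require Import boolp classical_sets reals topology normedtype derive.

Set Implicit Arguments.
Unset Strict Implicit.
Unset Printing Implicit Defensive.

Import Order.TTheory GRing.Theory Num.Theory.
Import numFieldNormedType.Exports.

Local Open Scope ring_scope.
Local Open Scope complex_scope.
Local Open Scope sesquilinear_scope.

Section Loewner.
Context {R : realType} {k : nat}.
Implicit Types A B : 'M[R[i]]_k.

(* The order on R[i] is partial: 0 <= z means that z is real and nonnegative. *)
Definition psdmx A : Prop :=
  A \is hermsymmx /\ forall v : 'rV[R[i]]_k, 0 <= (v *m A *m v ^t*) 0 0.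

Definition pdmx A : Prop :=
  A \is hermsymmx /\
  forall v : 'rV[R[i]]_k, v != 0 -> 0 < (v *m A *m v ^t*) 0 0.

Definition loewner_le A B : Prop := psdmx (B - A).

End Loewner.

Notation "A <=L B" := (loewner_le A B) (at level 70, no associativity).

(* Functional calculus by unitary diagonalization. It is meaningful for
   Hermitian A, whose eigenvalues are real; the result depends only on the
   values of f on the spectrum of A, so for positive definite A the values of
   f outside of (0, +oo) are irrelevant. *)
Definition fun_mx (R : realType) (k : nat) (f : R -> R) (A : 'M[R[i]]_k) :
    'M[R[i]]_k :=
  invmx (spectralmx A)
    *m diag_mx (map_mx (fun z => (f (complex.Re z))%:C) (spectral_diag A))
    *m spectralmx A.

Definition operator_monotone (R : realType) (g : R -> R) : Prop :=
  forall (k : nat) (A B : 'M[R[i]]_k),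
    pdmx A -> pdmx B -> A <=L B -> fun_mx g A <=L fun_mx g B.

(* The class of operator monotone functions written as a script L. *)
Definition opmonL (R : realType) (g : R -> R) : Prop :=
  [/\ operator_monotone g, g 1 = 0 & is_derive (1 : R) (1 : R) g 1].

Definition weight_vector (R : realType) (n : nat) (w : 'I_n -> R) : Prop :=
  (forall i, 0 < w i) /\ \sum_(i < n) w i = 1.

Definition invsqrt_mx (R : realType) (k : nat) (X : 'M[R[i]]_k) : 'M[R[i]]_k :=
  fun_mx (fun x : R => (Num.sqrt x)^-1) X.

Definition karcher_solution (R : realType) (n k : nat) (g : R -> R)
    (w : 'I_n -> R) (A : 'I_n -> 'M[R[i]]_k) (X : 'M[R[i]]_k) : Prop :=
  pdmx X /\
  \sum_(i < n) (w i)%:C *: fun_mx g (invsqrt_mx X *m A i *m invsqrt_mx X) = 0.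

(* The positive definite solution of the generalized Karcher equation, picked
   by choice; the default value 1 is taken only if there is no solution. *)
Definition sigma_mean (R : realType) (n k : nat) (g : R -> R)
    (w : 'I_n -> R) (A : 'I_n -> 'M[R[i]]_k) : 'M[R[i]]_k :=
  xget 1%:M [set X | karcher_solution g w A X]%classic.

Definition positive_map (R : realType) (k l : nat)
    (Phi : 'M[R[i]]_k -> 'M[R[i]]_l) : Prop :=
  forall A : 'M[R[i]]_k, psdmx A -> psdmx (Phi A).

Definition unital_map (R : realType) (k l : nat)
    (Phi : 'M[R[i]]_k -> 'M[R[i]]_l) : Prop :=
  Phi 1%:M = 1%:M.

Definition kantorovich (R : realType) (h : R) : R := (h + 1) ^+ 2 / (4 * h).

(* Main.v *)
(* Compressing an operator monotone g: if V is a coisometry and Z > 0, then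
   Z <= (1+e) V^H V Z V^H V + T (1 - V^H V) for T large, and applying g to both
   sides yields V g(Z) V^H <= g((1+e) V Z V^H). In dimension one this makes g
   concave, hence continuous, so e can be removed: this is Jensen's inequality,
   from which follow 1 - 1/x <= g x <= x - 1, the inequality
   Psi (g Z) <= g (Psi Z) of Choi and Davis for unital positive maps, and, for
   the perspective P(X, A) = X^1/2 g(X^-1/2 A X^-1/2) X^1/2 and 0 < X <= Y,
     P(X, A) + g(t) (Y - X) <= P(Y, A + t (Y - X)).           (1)

   Comparison: if sum_i w_i P(Y, A_i) >= 0 >= sum_i w_i P(X, A_i) then Y <= X.
   Otherwise Y <= l X with l > 1 minimal and v (l X - Y) = 0 for some v <> 0,
   and (1) at the vector v contradicts the strict monotonicity of g.

   Existence: by (1) the map X |-> X + (1/(j+1)) sum_i w_i P(X, A_i + t X) with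
   t = 1/(j+2) is monotone, because - g t <= 1/t - 1 = j+1. Iterating these maps
   from a large scalar gives a decreasing sequence; its limit solves the Karcher
   equation because the harmonic series diverges.

   If X solves the equation for the A_i, the Choi-Davis inequality for
   Z |-> Phi(X)^-1/2 Phi(X^1/2 Z X^1/2) Phi(X)^-1/2 makes Phi(X) a subsolution
   for the Phi(A_i), which gives the first inequality. The second one follows
   from X^-1 <= sum_i w_i A_i^-1, sigma_g(w; Phi(A)) <= sum_i w_i Phi(A_i) and
   A + m M A^-1 <= m + M <= m M X^-1 + K(h, 2) X. *)
Require Import Defs.
From HB Require Import structures.
From mathcomp Require Import all_boot all_order all_algebra.
From mathcomp Require Import complex.
From mathcomp Require Import boolp classical_sets reals topology normedtype derive.
From mathcomp Require Import sequences realfun.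
From mathcomp Require Import ring lra.

Set Implicit Arguments.
Unset Strict Implicit.
Unset Printing Implicit Defensive.

Import Order.TTheory GRing.Theory Num.Theory.
Import numFieldNormedType.Exports.

Local Open Scope classical_set_scope.
Local Open Scope ring_scope.
Local Open Scope complex_scope.
Local Open Scope sesquilinear_scope.

(** * Quadratic forms and functional calculus *)

(* Locked, like the other definitions below that depend on a matrix: conversion
   would otherwise unfold sums of products or the spectral decomposition. *)
HB.lock Definition qf (R : realType) k (A : 'M[R[i]]_k) (v : 'rV[R[i]]_k) : R :=
  complex.Re ((v *m A *m v^t*) 0 0).

Section QuadraticForms.
Context {R : realType}.
Implicit Types (k p q : nat).
Local Notation C := R[i].

Lemma adjmxM k p q (A : 'M[C]_(k, p)) (B : 'M[C]_(p, q)) :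
  (A *m B)^t* = B^t* *m A^t*.
Proof. by rewrite trmx_mul map_mxM. Qed.

Lemma conjC_realc (c : R) : Num.conj (c%:C : C) = c%:C.
Proof. by apply/CrealP; apply/complex_realP; exists c. Qed.

Lemma adjmxZ k p (c : R) (A : 'M[C]_(k, p)) : (c%:C *: A)^t* = c%:C *: A^t*.
Proof. by apply/matrixP => i j; rewrite !mxE rmorphM; congr (_ * _); exact: conjC_realc. Qed.

Lemma adjmxD k p (A B : 'M[C]_(k, p)) : (A + B)^t* = A^t* + B^t*.
Proof. by rewrite linearD /= map_mxD. Qed.

Lemma adjmxN k p (A : 'M[C]_(k, p)) : (- A)^t* = - A^t*.
Proof. by rewrite linearN /= map_mxN. Qed.

Lemma adjmx_scalar k (c : R) : ((c%:C)%:M : 'M[C]_k)^t* = (c%:C)%:M.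
Proof. by rewrite tr_scalar_mx map_scalar_mx /= conjC_realc. Qed.

Lemma adjmx1 k : (1%:M : 'M[C]_k)^t* = 1%:M.
Proof. by rewrite trmx1 map_mx1. Qed.

Definition herm k (A : 'M[C]_k) : Prop := A^t* = A.

Lemma hermsymmxP k (A : 'M[C]_k) : A \is hermsymmx <-> herm A.
Proof.
rewrite /herm; split; first by move/is_hermitianmxP; rewrite expr0 scale1r.
by move=> H; apply/is_hermitianmxP; rewrite expr0 scale1r.
Qed.

Lemma hermD k (A B : 'M[C]_k) : herm A -> herm B -> herm (A + B).
Proof. by rewrite /herm adjmxD => -> ->. Qed.

Lemma hermN k (A : 'M[C]_k) : herm A -> herm (- A).
Proof. by rewrite /herm adjmxN => ->. Qed.

Lemma hermB k (A B : 'M[C]_k) : herm A -> herm B -> herm (A - B).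
Proof. by move=> hA hB; apply: hermD => //; apply: hermN. Qed.

Lemma hermZ k (c : R) (A : 'M[C]_k) : herm A -> herm (c%:C *: A).
Proof. by rewrite /herm adjmxZ => ->. Qed.

Lemma herm1 k : herm (1%:M : 'M[C]_k).
Proof. exact: adjmx1. Qed.

Lemma herm0 k : herm (0 : 'M[C]_k).
Proof. by rewrite /herm trmx0 map_mx0. Qed.

Lemma herm_sum k n (F : 'I_n -> 'M[C]_k) :
  (forall i, herm (F i)) -> herm (\sum_i F i).
Proof.
move=> hF; apply: (big_ind (fun X => herm X)) => [|X Y|//]; first exact: herm0.
exact: hermD.
Qed.

Lemma herm_cong k p (K : 'M[C]_(p, k)) A : herm A -> herm (K *m A *m K^t*).
Proof. by rewrite /herm => hA; rewrite !adjmxM trmxCK hA mulmxA. Qed.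

Lemma ReD (x y : C) : complex.Re (x + y) = complex.Re x + complex.Re y.
Proof. by case: x y => [a b] [c d]. Qed.

Lemma ReN (x : C) : complex.Re (- x) = - complex.Re x.
Proof. by case: x => [a b]. Qed.

Lemma ReZ (c : R) (x : C) : complex.Re (c%:C * x) = c * complex.Re x.
Proof. by case: x => [a b] /=; rewrite mul0r subr0. Qed.

Lemma qfD k (A B : 'M[C]_k) v : qf (A + B) v = qf A v + qf B v.
Proof. by rewrite qf.unlock mulmxDr mulmxDl mxE ReD. Qed.

Lemma qfN k (A : 'M[C]_k) v : qf (- A) v = - qf A v.
Proof. by rewrite qf.unlock mulmxN mulNmx mxE ReN. Qed.

Lemma qfB k (A B : 'M[C]_k) v : qf (A - B) v = qf A v - qf B v.
Proof. by rewrite qfD qfN. Qed.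

Lemma qfZ k (c : R) (A : 'M[C]_k) v : qf (c%:C *: A) v = c * qf A v.
Proof. by rewrite qf.unlock -scalemxAr -scalemxAl mxE ReZ. Qed.

Lemma qf0 k v : qf (0 : 'M[C]_k) v = 0.
Proof. by rewrite qf.unlock mulmx0 mul0mx mxE. Qed.

Lemma qf0r k (A : 'M[C]_k) : qf A 0 = 0.
Proof. by rewrite qf.unlock !mul0mx mxE. Qed.

Lemma qf_sum k n (F : 'I_n -> 'M[C]_k) v :
  qf (\sum_i F i) v = \sum_i qf (F i) v.
Proof.
by apply: (big_morph (fun X => qf X v)) => [X Y|]; rewrite ?qfD ?qf0.
Qed.

Lemma qf_cong k p (K : 'M[C]_(p, k)) A v :
  qf (K *m A *m K^t*) v = qf A (v *m K).
Proof. by rewrite qf.unlock adjmxM !mulmxA. Qed.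

Definition normsq (z : C) : R := complex.Re z ^+ 2 + complex.Im z ^+ 2.

Lemma normsqE (z : C) : z * Num.conj z = (normsq z)%:C.
Proof. by rewrite -normCK /normsq add_Re2_Im2. Qed.

Lemma normsq_ge0 z : 0 <= normsq z.
Proof. by rewrite /normsq addr_ge0 ?sqr_ge0. Qed.

Lemma normsq_eq0 z : normsq z = 0 -> z = 0.
Proof.
move=> h; have := normsqE z; rewrite h => /eqP; rewrite mulf_eq0 conjC_eq0 orbb.
by move/eqP.
Qed.

Definition ediag k (d : 'I_k -> R) : 'M[C]_k := diag_mx (\row_j (d j)%:C).

Lemma Re_sum n (F : 'I_n -> C) :
  complex.Re (\sum_i F i) = \sum_i complex.Re (F i).
Proof. by apply: (big_morph (@complex.Re R)) => // x y; rewrite ReD. Qed.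

Lemma qf_ediag k (d : 'I_k -> R) v :
  qf (ediag d) v = \sum_j d j * normsq (v 0 j).
Proof.
rewrite qf.unlock mxE Re_sum; apply: eq_bigr => j _.
rewrite /ediag mul_mx_diag !mxE mulrAC normsqE mulrC ReZ //.
Qed.

Lemma qf1 k (v : 'rV[C]_k) : qf 1%:M v = \sum_j normsq (v 0 j).
Proof.
rewrite qf.unlock mulmx1 mxE Re_sum; apply: eq_bigr => j _.
by rewrite !mxE normsqE.
Qed.

Lemma qf1_ge0 k (v : 'rV[C]_k) : 0 <= qf 1%:M v.
Proof. by rewrite qf1 sumr_ge0 // => j _; exact: normsq_ge0. Qed.

Lemma qf1_gt0 k (v : 'rV[C]_k) : v != 0 -> 0 < qf 1%:M v.
Proof.
move=> v0; rewrite lt_def qf1_ge0 andbT; apply: contra v0.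
rewrite qf1 psumr_eq0; last by move=> j _; exact: normsq_ge0.
move/allP => h; apply/eqP/rowP => j; rewrite mxE; apply: normsq_eq0.
by apply/eqP; apply: h; rewrite mem_index_enum.
Qed.

Lemma herm_qfE k (A : 'M[C]_k) v :
  herm A -> (v *m A *m v^t*) 0 0 = (qf A v)%:C.
Proof.
move=> hA; rewrite qf.unlock RRe_real //; apply/CrealP.
have := herm_cong v hA; rewrite /herm; set M := _ *m _ *m _ => /matrixP/(_ 0 0).
by rewrite mxE [M^T _ _]mxE.
Qed.

Lemma psdmxP k (A : 'M[C]_k) :
  psdmx A <-> herm A /\ forall v, 0 <= qf A v.
Proof.
split=> [[/hermsymmxP hA pA]|[hA pA]].
  by split=> // v; have := pA v; rewrite herm_qfE // ler0c.
split=> [|v]; first by apply/hermsymmxP.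
by rewrite herm_qfE // ler0c.
Qed.

Lemma pdmxP k (A : 'M[C]_k) :
  pdmx A <-> herm A /\ forall v, v != 0 -> 0 < qf A v.
Proof.
split=> [[/hermsymmxP hA pA]|[hA pA]].
  by split=> // v /pA; rewrite herm_qfE // ltcR.
split=> [|v v0]; first by apply/hermsymmxP.
by rewrite herm_qfE // ltcR; exact: pA.
Qed.

Lemma pd_herm k (A : 'M[C]_k) : pdmx A -> herm A.
Proof. by case/pdmxP. Qed.

Lemma pd_qf k (A : 'M[C]_k) v : pdmx A -> v != 0 -> 0 < qf A v.
Proof. by case/pdmxP => _; apply. Qed.

Lemma pd_qf_ge0 k (A : 'M[C]_k) v : pdmx A -> 0 <= qf A v.
Proof.
by move=> pA; have [->|v0] := eqVneq v 0; [rewrite qf0r | exact/ltW/pd_qf].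
Qed.

(** No Hermitian condition is carried along, so inequalities chain as inequalities between real
    numbers; [loewnerP] returns to the Loewner order for Hermitian matrices. *)
Definition qle k (A B : 'M[C]_k) : Prop := forall v, qf A v <= qf B v.

Lemma qle_trans k (A B D : 'M[C]_k) : qle A B -> qle B D -> qle A D.
Proof. by move=> h1 h2 v; exact: le_trans (h1 v) (h2 v). Qed.

Lemma loewnerP k (A B : 'M[C]_k) : herm A -> herm B -> (A <=L B <-> qle A B).
Proof.
move=> hA hB; rewrite /loewner_le; split=> [/psdmxP[_ h] v|h].
  by have := h v; rewrite qfB subr_ge0.
by apply/psdmxP; split=> [|v]; [exact: hermB|rewrite qfB subr_ge0].
Qed.

Lemma loewner_qle k (A B : 'M[C]_k) : A <=L B -> qle A B.
Proof. by case/psdmxP => _ h v; have := h v; rewrite qfB subr_ge0. Qed.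

Lemma qle_cong k p (K : 'M[C]_(p, k)) A B :
  qle A B -> qle (K *m A *m K^t*) (K *m B *m K^t*).
Proof. by move=> h v; rewrite !qf_cong. Qed.

Lemma qf_scalar k (c : R) v : qf ((c%:C)%:M : 'M[C]_k) v = c * qf 1%:M v.
Proof. by rewrite -[(_%:C)%:M]scalemx1 qfZ. Qed.

End QuadraticForms.

HB.lock Definition eigvecs (R : realType) k (A : 'M[R[i]]_k) : 'M[R[i]]_k :=
  spectralmx A.

HB.lock Definition eig (R : realType) k (A : 'M[R[i]]_k) (j : 'I_k) : R :=
  complex.Re (spectral_diag A 0 j).

HB.lock Definition fcalc (R : realType) k (f : R -> R) (A : 'M[R[i]]_k) :
  'M[R[i]]_k := fun_mx f A.

Section FunctionalCalculus.
Context {R : realType}.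
Implicit Types (k p q : nat) (f h : R -> R).
Local Notation C := R[i].

Lemma eigvecsK k (A : 'M[C]_k) : (eigvecs A)^t* *m eigvecs A = 1%:M.
Proof.
rewrite eigvecs.unlock.
by rewrite -invmx_unitary ?spectral_unitarymx // mulVmx // spectral_unit.
Qed.

Lemma eigvecsKV k (A : 'M[C]_k) : eigvecs A *m (eigvecs A)^t* = 1%:M.
Proof. by rewrite eigvecs.unlock; apply/eqP; exact: spectral_unitarymx. Qed.

Lemma fcalcE k f (A : 'M[C]_k) :
  fcalc f A = (eigvecs A)^t* *m ediag (fun j => f (eig A j)) *m eigvecs A.
Proof.
have -> : ediag (fun j => f (eig A j)) =
    diag_mx (map_mx (fun z => (f (complex.Re z))%:C) (spectral_diag A)).
  by rewrite /ediag; congr diag_mx; apply/rowP => j; rewrite !mxE eig.unlock.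
by rewrite fcalc.unlock eigvecs.unlock /fun_mx invmx_unitary ?spectral_unitarymx.
Qed.

Lemma spectralE k (A : 'M[C]_k) : herm A ->
  A = (eigvecs A)^t* *m ediag (eig A) *m eigvecs A.
Proof.
move/hermsymmxP => hA.
have /orthomx_spectralP e := hermitian_normalmx hA.
have -> : ediag (eig A) = diag_mx (spectral_diag A).
  rewrite /ediag; congr diag_mx; apply/rowP => j; rewrite !mxE eig.unlock RRe_real //.
  by have /mxOverP := hermitian_spectral_diag_real hA.
by rewrite eigvecs.unlock {1}e invmx_unitary ?spectral_unitarymx.
Qed.



Lemma ediag_herm k (d : 'I_k -> R) : herm (ediag d).
Proof.
rewrite /herm /ediag tr_diag_mx map_diag_mx; congr diag_mx.
by apply/rowP => j; rewrite !mxE; exact: conjC_realc.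
Qed.

Lemma fcalc_herm k f (A : 'M[C]_k) : herm (fcalc f A).
Proof.
rewrite fcalcE -{2}[eigvecs A]trmxCK; apply: herm_cong; exact: ediag_herm.
Qed.

(** Entrywise the hypothesis reads d_i K_ij = K_ij e_j, so d_i = e_j wherever K_ij is nonzero. *)
Lemma ediag_intertwine k p f d e (K : 'M[C]_(k, p)) :
  ediag d *m K = K *m ediag e ->
  ediag (fun i => f (d i)) *m K = K *m ediag (fun j => f (e j)).
Proof.
rewrite /ediag !mul_diag_mx !mul_mx_diag => /matrixP E; apply/matrixP => i j.
have := E i j; rewrite !mxE => Eij.
have [->|K0] := eqVneq (K i j) 0; first by rewrite mulr0 mul0r.
move: Eij; rewrite mulrC => /(mulfI K0) /complexI ->; exact: mulrC.
Qed.

(** In the two eigenbases [K] becomes an intertwiner of diagonal matrices. Since [K] may be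
    rectangular, this computes [fcalc] on blocks and compressions without access to their spectral
    decompositions. *)
Lemma fcalc_intertwine k p f (A : 'M[C]_k) (B : 'M[C]_p) K :
  herm A -> herm B -> A *m K = K *m B -> fcalc f A *m K = K *m fcalc f B.
Proof.
move=> hA hB E; rewrite !fcalcE.
set U := eigvecs A; set V := eigvecs B.
have UK : U *m U^t* = 1%:M by exact: eigvecsKV.
have VK : V *m V^t* = 1%:M by exact: eigvecsKV.
have : ediag (eig A) *m (U *m K *m V^t*) = (U *m K *m V^t*) *m ediag (eig B).
  have -> : ediag (eig A) = U *m A *m U^t*.
    rewrite [in RHS](spectralE hA) -/U !mulmxA UK mul1mx -mulmxA UK mulmx1 //.
  have -> : ediag (eig B) = V *m B *m V^t*.
    rewrite [in RHS](spectralE hB) -/V !mulmxA VK mul1mx -mulmxA VK mulmx1 //.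
  have UK' : U^t* *m U = 1%:M by exact: eigvecsK.
  have VK' : V^t* *m V = 1%:M by exact: eigvecsK.
  rewrite !mulmxA -[_ *m U^t* *m U]mulmxA UK' mulmx1 -[_ *m V^t* *m V]mulmxA VK'.
  by rewrite mulmx1 -!mulmxA; congr (_ *m _); rewrite !mulmxA E.
move/(ediag_intertwine f) => EE.
have VK' : V^t* *m V = 1%:M by exact: eigvecsK.
have UK' : U^t* *m U = 1%:M by exact: eigvecsK.
transitivity (U^t* *m (ediag (fun j => f (eig A j)) *m (U *m K *m V^t*)) *m V).
  by rewrite !mulmxA -[_ *m V^t* *m V]mulmxA VK' mulmx1.
by rewrite EE !mulmxA UK' mul1mx.
Qed.

Lemma eq_fcalc k f h (A : 'M[C]_k) :
  (forall j, f (eig A j) = h (eig A j)) -> fcalc f A = fcalc h A.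
Proof.
move=> E; rewrite !fcalcE.
suff -> : ediag (fun j => f (eig A j)) = ediag (fun j => h (eig A j)) by [].
by rewrite /ediag; congr diag_mx; apply/rowP => j; rewrite !mxE E.
Qed.

Lemma fcalc_id k (A : 'M[C]_k) : herm A -> fcalc (fun x => x) A = A.
Proof. by move=> hA; rewrite fcalcE -spectralE. Qed.

Lemma ediagD k (d e : 'I_k -> R) : ediag (fun j => d j + e j) = ediag d + ediag e.
Proof.
apply/matrixP => i j; rewrite !mxE rmorphD /= mulrnDl //.
Qed.

Lemma ediagZ k c (d : 'I_k -> R) : ediag (fun j => c * d j) = c%:C *: ediag d.
Proof.
by apply/matrixP => i j; rewrite !mxE rmorphM /= mulrnAr.
Qed.

Lemma ediagM k (d e : 'I_k -> R) : ediag (fun j => d j * e j) = ediag d *m ediag e.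
Proof.
rewrite /ediag mulmx_diag; congr diag_mx; apply/rowP => j.
by rewrite !mxE rmorphM.
Qed.

Lemma ediag_cst k (c : R) : ediag (fun _ : 'I_k => c) = (c%:C)%:M.
Proof. by apply/matrixP => i j; rewrite !mxE. Qed.

Lemma fcalcD k f h (A : 'M[C]_k) :
  fcalc (fun x => f x + h x) A = fcalc f A + fcalc h A.
Proof. by rewrite !fcalcE ediagD mulmxDr mulmxDl. Qed.

Lemma fcalcZ k c f (A : 'M[C]_k) :
  fcalc (fun x => c * f x) A = c%:C *: fcalc f A.
Proof. by rewrite !fcalcE ediagZ -scalemxAr -scalemxAl. Qed.

Lemma fcalcN k f (A : 'M[C]_k) : fcalc (fun x => - f x) A = - fcalc f A.
Proof.
rewrite -scaleN1r -[-1]/(- (1%:C)) -rmorphN -fcalcZ.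
by apply: eq_fcalc => j; rewrite mulN1r.
Qed.

Lemma fcalcM k f h (A : 'M[C]_k) :
  fcalc (fun x => f x * h x) A = fcalc f A *m fcalc h A.
Proof.
rewrite !fcalcE ediagM !mulmxA -[_ *m eigvecs A *m _]mulmxA eigvecsKV.
by rewrite mulmx1.
Qed.

Lemma fcalc_cst k c (A : 'M[C]_k) : fcalc (fun _ => c) A = (c%:C)%:M.
Proof. by rewrite fcalcE ediag_cst -mulmxA mul_scalar_mx -scalemxAr eigvecsK scalemx1. Qed.

Lemma fcalc_scalar k f c : fcalc f ((c%:C)%:M : 'M[C]_k) = ((f c)%:C)%:M.
Proof.
rewrite -(fcalc_cst (f c) ((c%:C)%:M : 'M[C]_k)); apply: eq_fcalc => j.
congr f; set A := _%:M.
have hA : herm A by exact: adjmx_scalar.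
(* A scalar matrix is unchanged by conjugation, so its diagonal form is [A] itself in whatever
   eigenbasis was chosen. *)
have /matrixP/(_ j j) : ediag (eig A) = A.
  have h := spectralE hA; transitivity (eigvecs A *m A *m (eigvecs A)^t*).
    rewrite [X in _ *m X *m _]h !mulmxA eigvecsKV mul1mx -mulmxA.
    by rewrite eigvecsKV mulmx1.
  by rewrite /A mul_mx_scalar -scalemxAl eigvecsKV scalemx1.
by rewrite !mxE eqxx !mulr1n => /complexI.
Qed.

Lemma qf_fcalc k f (A : 'M[C]_k) v :
  qf (fcalc f A) v =
  \sum_j f (eig A j) * normsq ((v *m (eigvecs A)^t*) 0 j).
Proof.
by rewrite fcalcE -{2}[eigvecs A]trmxCK qf_cong qf_ediag.
Qed.

Lemma fcalc_qle k f h (A : 'M[C]_k) :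
  (forall j, f (eig A j) <= h (eig A j)) -> qle (fcalc f A) (fcalc h A).
Proof.
move=> fh v; rewrite (qf_fcalc f) (qf_fcalc h).
apply: ler_sum => j _.
by rewrite ler_wpM2r ?normsq_ge0.
Qed.

Lemma fcalc_pd k f (A : 'M[C]_k) :
  (forall j, 0 < f (eig A j)) -> pdmx (fcalc f A).
Proof.
move=> f0; apply/pdmxP; split=> [|v v0]; first exact: fcalc_herm.
set w := v *m (eigvecs A)^t*.
have w0 : w != 0.
  apply: contra v0 => /eqP w0; rewrite -[v]mulmx1 -(eigvecsK A) mulmxA -/w w0.
  by rewrite mul0mx.
have := qf1_gt0 w0; rewrite qf_fcalc -/w qf1 => h.
have h0 j : 0 <= f (eig A j) * normsq (w 0 j).
  by rewrite mulr_ge0 ?normsq_ge0 // ltW.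
rewrite lt_def sumr_ge0 // andbT; apply: contraL h.
rewrite psumr_eq0 // => /allP e0.
rewrite big1 ?ltxx // => j _; apply/eqP.
have := e0 j; rewrite mem_index_enum => /(_ isT).
by rewrite mulf_eq0 gt_eqF //= f0.
Qed.

(** Vectors are rows here, so the rows of [eigvecs A] are unit eigenvectors; evaluating forms at
    them turns order bounds into eigenvalue bounds. *)
Lemma qf_eig k (A : 'M[C]_k) j : herm A ->
  qf A (row j (eigvecs A)) = eig A j /\ qf 1%:M (row j (eigvecs A)) = 1.
Proof.
move=> hA; set U := eigvecs A.
have rU : row j U *m U^t* = delta_mx 0 j.
  by rewrite -row_mul eigvecsKV rowE mulmx1.
have rd i : normsq ((delta_mx 0 j : 'rV[C]_k) 0 i) = (i == j)%:R.
  by rewrite mxE eqxx /normsq /=; case: (i == j); rewrite /= expr0n ?expr1n addr0.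
split.
  rewrite -[A in qf A]fcalc_id // qf_fcalc -/U rU.
  rewrite (bigD1 j) //= rd eqxx mulr1 big1 ?addr0 // => i /negPf ij.
  by rewrite rd ij mulr0.
have -> : 1%:M = U^t* *m 1%:M *m U^t*^t* by rewrite mulmx1 trmxCK eigvecsK.
rewrite qf_cong rU qf1 (bigD1 j) //= rd eqxx big1 ?addr0 // => i /negPf ij.
by rewrite rd ij.
Qed.

Lemma eig_row_neq0 k (A : 'M[C]_k) j : herm A -> row j (eigvecs A) != 0.
Proof.
move=> hA; apply/eqP => e; have [_] := qf_eig j hA.
by rewrite e qf0r => /esym /eqP; rewrite oner_eq0.
Qed.

Lemma eig_gt0 k (A : 'M[C]_k) j : pdmx A -> 0 < eig A j.
Proof.
move=> pA; have hA := pd_herm pA; have [<- _] := qf_eig j hA.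
by apply: pd_qf => //; exact: eig_row_neq0.
Qed.

Lemma eig_ge k (A : 'M[C]_k) c j :
  herm A -> qle (c%:C)%:M A -> c <= eig A j.
Proof.
move=> hA /(_ (row j (eigvecs A))); have [-> e] := qf_eig j hA.
by rewrite qf_scalar e mulr1.
Qed.

Lemma eig_le k (A : 'M[C]_k) c j :
  herm A -> qle A (c%:C)%:M -> eig A j <= c.
Proof.
move=> hA /(_ (row j (eigvecs A))); have [-> e] := qf_eig j hA.
by rewrite qf_scalar e mulr1.
Qed.

Lemma herm_qf0 k (A : 'M[C]_k) : herm A -> (forall v, qf A v = 0) -> A = 0.
Proof.
move=> hA h; rewrite -(fcalc_id hA).
rewrite (@eq_fcalc _ _ (fun=> 0)); first by rewrite fcalc_cst /= raddf0.
by move=> j; have [<- _] := qf_eig j hA; exact: h.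
Qed.

End FunctionalCalculus.

(** * Positive definite matrices *)

Section PositiveDefinite.
Context {R : realType}.
Implicit Types (k p q : nat) (f h : R -> R).
Local Notation C := R[i].

(** The decomposition chosen for [ediag d] need not be the evident one, so the diagonal side is kept
    explicit. Taking [K] to be 1 evaluates [fcalc] on diagonal matrices; taking the adjoint of the
    eigenvectors gives the composition rule. *)
Lemma fcalc_ediag_intertwine k p f (A : 'M[C]_k) d (K : 'M[C]_(k, p)) :
  herm A -> A *m K = K *m ediag d ->
  fcalc f A *m K = K *m ediag (fun j => f (d j)).
Proof.
move=> hA E; rewrite fcalcE.
have : ediag (eig A) *m (eigvecs A *m K) = (eigvecs A *m K) *m ediag d.
  by rewrite -mulmxA -E [X in _ = _ *m (X *m _)](spectralE hA) !mulmxA eigvecsKV mul1mx.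
move/(ediag_intertwine f) => EE.
by rewrite -!mulmxA EE !mulmxA eigvecsK mul1mx.
Qed.

Lemma fcalc_ediag k f (d : 'I_k -> R) : fcalc f (ediag d) = ediag (fun j => f (d j)).
Proof.
have := @fcalc_ediag_intertwine _ _ f _ d 1%:M (ediag_herm d).
by rewrite !mulmx1 !mul1mx; exact.
Qed.

Lemma fcalc_comp k f h (A : 'M[C]_k) :
  fcalc f (fcalc h A) = fcalc (fun x => f (h x)) A.
Proof.
have E : fcalc h A *m (eigvecs A)^t* = (eigvecs A)^t* *m ediag (fun j => h (eig A j)).
  by rewrite fcalcE -!mulmxA eigvecsKV mulmx1.
have := fcalc_ediag_intertwine f (fcalc_herm h A) E => E2.
by rewrite [RHS]fcalcE -E2 -mulmxA eigvecsK mulmx1.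
Qed.

Lemma pd_scalar k (c : R) : 0 < c -> pdmx ((c%:C)%:M : 'M[C]_k).
Proof.
move=> c0; apply/pdmxP; split=> [|v v0]; first exact: adjmx_scalar.
by rewrite qf_scalar mulr_gt0 // qf1_gt0.
Qed.

Lemma ediag_pd k (d : 'I_k -> R) : (forall j, 0 < d j) -> pdmx (ediag d).
Proof.
(* Starting the minimum from 1 keeps it positive, also when k = 0. *)
move=> d0; have c0 : 0 < \big[Num.min/1]_j d j.
  by apply: (big_ind (fun x => 0 < x)) => // x y x0 y0; rewrite lt_min x0 y0.
apply/pdmxP; split=> [|v v0]; first exact: ediag_herm.
apply: lt_le_trans (pd_qf (pd_scalar k c0) v0) _.
rewrite -ediag_cst !qf_ediag; apply: ler_sum => j _.
by rewrite ler_wpM2r ?normsq_ge0 // (bigD1 j) //= ge_min lexx.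
Qed.

Lemma pdD k (A B : 'M[C]_k) : pdmx A -> herm B -> (forall v, 0 <= qf B v) ->
  pdmx (A + B).
Proof.
move=> pA hB B0; apply/pdmxP; split=> [|v v0]; first by apply: hermD => //; exact: pd_herm.
by rewrite qfD ltr_wpDr // pd_qf.
Qed.

Lemma pdZ k c (A : 'M[C]_k) : 0 < c -> pdmx A -> pdmx (c%:C *: A).
Proof.
move=> c0 pA; apply/pdmxP; split=> [|v v0]; first by apply: hermZ; exact: pd_herm.
by rewrite qfZ mulr_gt0 // pd_qf.
Qed.

Lemma pd_ge k (A B : 'M[C]_k) : pdmx A -> herm B -> qle A B -> pdmx B.
Proof.
move=> pA hB AB; apply/pdmxP; split=> // v v0.
exact: lt_le_trans (pd_qf pA v0) (AB v).
Qed.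

Lemma pd_cong k (A K K' : 'M[C]_k) : pdmx A -> K *m K' = 1%:M ->
  pdmx (K *m A *m K^t*).
Proof.
move=> pA KK; apply/pdmxP; split=> [|v v0]; first exact/herm_cong/pd_herm.
rewrite qf_cong; apply: pd_qf => //; apply: contra v0 => /eqP e.
by rewrite -[v]mulmx1 -KK mulmxA e mul0mx.
Qed.

Lemma pd_lower k (A : 'M[C]_k) : pdmx A ->
  exists2 c : R, 0 < c & qle (c%:C)%:M A.
Proof.
move=> pA; have hA := pd_herm pA.
have : exists2 c : R, 0 < c & forall j, c <= eig A j.
  exists (\big[Num.min/1]_j eig A j).
    by apply: (big_ind (fun x => 0 < x)) => // [x y x0 y0|j _];
      [rewrite lt_min x0 y0|exact: eig_gt0].
  by move=> j; rewrite (bigD1 j) //= ge_min lexx.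
case=> c c0 h; exists c => //.
rewrite -(fcalc_cst c A) -[X in qle _ X](fcalc_id hA); exact: fcalc_qle.
Qed.

Lemma herm_upper k (A : 'M[C]_k) : herm A ->
  exists2 c : R, 0 < c & qle A (c%:C)%:M.
Proof.
move=> hA.
have : exists2 c : R, 0 < c & forall j, eig A j <= c.
  exists (\big[Num.max/1]_j eig A j).
    by elim/big_rec: _ => // j x _ x0; rewrite lt_max x0 orbT.
  by move=> j; rewrite (bigD1 j) //= le_max lexx.
case=> c c0 h; exists c => //.
rewrite -(fcalc_cst c A) -[X in qle X _](fcalc_id hA); exact: fcalc_qle.
Qed.

(** * Square roots and inverses of positive definite matrices *)

Definition msqrt k (A : 'M[C]_k) := fcalc Num.sqrt A.
Definition mrsqrt k (A : 'M[C]_k) := fcalc (fun x => (Num.sqrt x)^-1) A.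
Definition minv k (A : 'M[C]_k) := fcalc (fun x => x^-1) A.

Lemma msqrt_herm k (A : 'M[C]_k) : herm (msqrt A).
Proof. exact: fcalc_herm. Qed.

Lemma mrsqrt_herm k (A : 'M[C]_k) : herm (mrsqrt A).
Proof. exact: fcalc_herm. Qed.

Lemma minv_herm k (A : 'M[C]_k) : herm (minv A).
Proof. exact: fcalc_herm. Qed.

Lemma fcalc_cst1 k (A : 'M[C]_k) f : (forall j, f (eig A j) = 1) -> fcalc f A = 1%:M.
Proof. by move=> h; rewrite (@eq_fcalc _ _ f (fun=> 1)) // fcalc_cst. Qed.

Lemma msqrtK k (A : 'M[C]_k) : pdmx A -> msqrt A *m msqrt A = A.
Proof.
move=> pA; rewrite /msqrt -fcalcM -[RHS](fcalc_id (pd_herm pA)).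
by apply: eq_fcalc => j; rewrite -expr2 sqr_sqrtr // ltW // eig_gt0.
Qed.

Lemma psd_sqrt k (A : 'M[C]_k) : herm A -> (forall v, 0 <= qf A v) ->
  msqrt A *m msqrt A = A.
Proof.
move=> hA A0; rewrite /msqrt -fcalcM -[RHS](fcalc_id hA).
apply: eq_fcalc => j; rewrite -expr2 sqr_sqrtr //.
by have [<- _] := qf_eig j hA.
Qed.

Lemma sqrtV_neq0 k (A : 'M[C]_k) j : pdmx A -> Num.sqrt (eig A j) != 0.
Proof. by move=> pA; rewrite gt_eqF // sqrtr_gt0 eig_gt0. Qed.

Lemma mrsqrt_msqrt k (A : 'M[C]_k) : pdmx A -> mrsqrt A *m msqrt A = 1%:M.
Proof.
move=> pA; rewrite /mrsqrt /msqrt -fcalcM; apply: fcalc_cst1 => j.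
by rewrite mulVf // sqrtV_neq0.
Qed.

Lemma msqrt_mrsqrt k (A : 'M[C]_k) : pdmx A -> msqrt A *m mrsqrt A = 1%:M.
Proof.
move=> pA; rewrite /mrsqrt /msqrt -fcalcM; apply: fcalc_cst1 => j.
by rewrite mulfV // sqrtV_neq0.
Qed.

Lemma mulmx_minv k (A : 'M[C]_k) : pdmx A -> A *m minv A = 1%:M.
Proof.
move=> pA; rewrite -{1}(fcalc_id (pd_herm pA)) -fcalcM; apply: fcalc_cst1 => j.
by rewrite mulfV // gt_eqF // eig_gt0.
Qed.

Lemma minv_mulmx k (A : 'M[C]_k) : pdmx A -> minv A *m A = 1%:M.
Proof.
move=> pA; rewrite -{2}(fcalc_id (pd_herm pA)) -fcalcM; apply: fcalc_cst1 => j.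
by rewrite mulVf // gt_eqF // eig_gt0.
Qed.

Lemma minv_pd k (A : 'M[C]_k) : pdmx A -> pdmx (minv A).
Proof. by move=> pA; apply: fcalc_pd => j; rewrite invr_gt0 eig_gt0. Qed.

Lemma minvE k (A B : 'M[C]_k) : pdmx A -> A *m B = 1%:M -> minv A = B.
Proof. by move=> pA AB; rewrite -[B]mul1mx -(minv_mulmx pA) -mulmxA AB mulmx1. Qed.

Lemma mrsqrtK k (A : 'M[C]_k) : pdmx A -> mrsqrt A *m mrsqrt A = minv A.
Proof.
move=> pA; rewrite /mrsqrt -fcalcM; apply: eq_fcalc => j.
by rewrite -invfM -expr2 sqr_sqrtr // ltW // eig_gt0.
Qed.

(* With D = A^-1 - B^-1 one has 0 <= D A D = A^-1 - 2 B^-1 + B^-1 A B^-1,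
   and B^-1 A B^-1 <= B^-1. *)
Lemma minv_qle k (A B : 'M[C]_k) : pdmx A -> pdmx B -> qle A B ->
  qle (minv B) (minv A).
Proof.
move=> pA pB AB v.
have hD : herm (minv A - minv B) by apply: hermB; exact: minv_herm.
have := pd_qf_ge0 (v *m (minv A - minv B)) pA.
rewrite -qf_cong hD mulmxBl (minv_mulmx pA) mulmxBl mul1mx mulmxBr.
rewrite -mulmxA (mulmx_minv pA) mulmx1 !qfB.
have := qle_cong (minv B) AB v.
rewrite (minv_herm B) (minv_mulmx pB) mul1mx; lra.
Qed.

(** Here l is the largest eigenvalue of X^-1/2 Y X^-1/2, and v is a unit eigenvector for it
    multiplied by X^-1/2. *)
Lemma not_qle_eigenvector k (X Y : 'M[C]_k) : pdmx X -> herm Y ->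
  ~ qle Y X -> exists (l : R) (v : 'rV[C]_k),
    [/\ 1 < l, v != 0, qle Y (l%:C *: X) & qf Y v = l * qf X v].
Proof.
move=> pX hY nYX.
set K := mrsqrt X; have hK : K^t* = K by exact: mrsqrt_herm.
set L := msqrt X; have hL : L^t* = L by exact: msqrt_herm.
have KL : K *m L = 1%:M by exact: mrsqrt_msqrt.
have LK : L *m K = 1%:M by exact: msqrt_mrsqrt.
set Z := K *m Y *m K.
have hZ : herm Z by rewrite /Z -{2}hK; exact: herm_cong.
have YE : Y = L *m Z *m L^t*.
  by rewrite hL /Z !mulmxA LK mul1mx -mulmxA KL mulmx1.
have XE : X = L *m 1%:M *m L^t* by rewrite hL mulmx1 msqrtK.
(* In dimension 0 every form vanishes, so [qle Y X] would hold; hence an index is available for the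
   maximum. *)
have [j0 _|k0] := pickP 'I_k; last first.
  case: nYX => v; suff -> : v = 0 by rewrite !qf0r.
  by apply/rowP => j; have := k0 j.
have [j _ jmax] := @arg_maxP _ R 'I_k j0 xpredT (eig Z) isT.
have Zle : qle Z ((eig Z j)%:C)%:M.
  rewrite -(fcalc_cst _ Z) -{1}(fcalc_id hZ); apply: fcalc_qle => i.
  exact: jmax.
exists (eig Z j), (row j (eigvecs Z) *m K).
have eX : qf X (row j (eigvecs Z) *m K) = 1.
  rewrite XE qf_cong -mulmxA KL mulmx1; exact: (qf_eig j hZ).2.
have eY : qf Y (row j (eigvecs Z) *m K) = eig Z j.
  rewrite YE qf_cong -mulmxA KL mulmx1; exact: (qf_eig j hZ).1.
have YX : qle Y ((eig Z j)%:C *: X).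
  move=> v; rewrite YE XE qfZ !qf_cong; have := Zle (v *m L).
  by rewrite qf_scalar.
split=> //; last by rewrite eX mulr1.
  rewrite ltNge; apply/negP => l1; apply: nYX => v; apply: le_trans (YX v) _.
  by rewrite qfZ ler_piMl // pd_qf_ge0.
apply/eqP => e0; have := eX; rewrite e0 qf0r => /esym/eqP.
by rewrite oner_eq0.
Qed.

End PositiveDefinite.

(** * Compressions of operator monotone functions *)

Section OperatorMonotone.
Context {R : realType}.
Implicit Types (k p q : nat) (g : R -> R).
Local Notation C := R[i].

Lemma opmon_qle g k (A B : 'M[C]_k) : operator_monotone g ->
  pdmx A -> pdmx B -> qle A B -> qle (fcalc g A) (fcalc g B).
Proof.
move=> mg pA pB AB; rewrite fcalc.unlock; apply: loewner_qle; apply: mg => //.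
by apply/loewnerP => //; exact: pd_herm.
Qed.

Lemma qle_scalar (x y : R) : qle ((x%:C)%:M : 'M[C]_1) (y%:C)%:M <-> x <= y.
Proof.
split=> [h|xy v]; last first.
  by rewrite (qf_scalar x) (qf_scalar y) ler_wpM2r // qf1_ge0.
have := h (const_mx 1); rewrite (qf_scalar x) (qf_scalar y) ler_pM2r // qf1_gt0 //.
by apply/eqP => /matrixP/(_ 0 0)/eqP; rewrite !mxE oner_eq0.
Qed.

Lemma opmon_mono g x y : operator_monotone g -> 0 < x -> x <= y -> g x <= g y.
Proof.
move=> mg x0 xy; apply/qle_scalar; rewrite -!fcalc_scalar.
apply: opmon_qle => //; try exact: pd_scalar.
  by apply: pd_scalar; exact: lt_le_trans xy.
exact/qle_scalar.
Qed.

(** With s^2 = e, the form of Z at v (s P - s^-1 Q) is nonnegative, which bounds the cross terms P Z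
    Q + Q Z P by e P Z P + e^-1 Q Z Q. *)
Lemma qf_young k (P Q Z : 'M[C]_k) (e : R) v :
  pdmx Z -> herm P -> herm Q -> P + Q = 1%:M -> 0 < e ->
  qf Z v <= (1 + e) * qf (P *m Z *m P) v + (1 + e^-1) * qf (Q *m Z *m Q) v.
Proof.
move=> pZ hP hQ PQ e0.
have ZE : P *m Z *m P + Q *m Z *m Q + (P *m Z *m Q + Q *m Z *m P) = Z.
  rewrite addrACA -mulmxDr [Q *m Z *m Q + _]addrC -mulmxDr PQ !mulmx1.
  by rewrite -mulmxDl PQ mul1mx.
have [s s0 ss] : exists2 s : R, 0 < s & s * s = e.
  by exists (Num.sqrt e); rewrite ?sqrtr_gt0 // -expr2 sqr_sqrtr // ltW.
have hK : herm (s%:C *: P + (- s^-1)%:C *: Q) by apply: hermD; exact: hermZ.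
have := pd_qf_ge0 (v *m (s%:C *: P + (- s^-1)%:C *: Q)) pZ.
rewrite -qf_cong hK mulmxDl mulmxDr !mulmxDl -!scalemxAl -!scalemxAr -[in qf Z v]ZE.
move: (P *m Z *m P) (Q *m Z *m Q) (P *m Z *m Q) (Q *m Z *m P) => X1 X2 X3 X4.
rewrite !qfD !qfZ; move: (qf X1 v) (qf X2 v) (qf X3 v) (qf X4 v) => a b c d.
rewrite !(mulNr, mulrN, opprK) !mulrA ss -invfM ss mulfV ?gt_eqF //.
rewrite mulVf ?gt_eqF //; lra.
Qed.

(* Any e > 0 and a large T give Z <= (1+e) V^H V Z V^H V + T (1 - V^H V), and
   the right-hand side is intertwined by V^H with (1+e) V Z V^H. *)
Lemma opmon_compress_approx g p q (V : 'M[C]_(p, q)) (Z : 'M[C]_q) (e : R) :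
  operator_monotone g -> V *m V^t* = 1%:M -> pdmx Z -> 0 < e ->
  qle (V *m fcalc g Z *m V^t*) (fcalc g ((1 + e)%:C *: (V *m Z *m V^t*))).
Proof.
move=> mg VV pZ e0; have hZ := pd_herm pZ.
have [z z0 zZ] := herm_upper hZ.
set B := _ *: _; have hB : herm B by apply: hermZ; exact: herm_cong.
set P := V^t* *m V; set Q := 1%:M - P.
have hP : P^t* = P by rewrite /P adjmxM trmxCK.
have hQ : Q^t* = Q by rewrite /Q adjmxD adjmxN adjmx1 hP.
have PP : P *m P = P by rewrite /P mulmxA -[_ *m V *m _]mulmxA VV mulmx1.
have QQ : Q *m Q = Q.
  by rewrite /Q mulmxBl mul1mx mulmxBr mulmx1 PP subrr subr0.
have QV : Q *m V^t* = 0 by rewrite /Q mulmxBl mul1mx /P -mulmxA VV mulmx1 subrr.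
(* This is the majorant of Z: the factor 1 + 1/e comes from [qf_young], and z bounds Z on the range
   of Q. *)
set W := V^t* *m B *m V + ((1 + e^-1) * z)%:C *: Q.
have hW : herm W.
  apply: hermD; last exact: hermZ.
  by rewrite -{2}[V]trmxCK; exact: herm_cong.
have ZW : qle Z W.
  move=> v.
  have /(_ v) qQ := qle_cong Q zZ.
  have qQ1 : qf (Q *m (z%:C)%:M *m Q^t*) v = z * qf Q v.
    by rewrite hQ mul_mx_scalar -scalemxAl QQ qfZ.
  have qP : qf (V^t* *m B *m V) v = (1 + e) * qf (P *m Z *m P) v.
    by rewrite /B -scalemxAr -scalemxAl qfZ /P !mulmxA.
  have PQ : P + Q = 1%:M by rewrite /Q addrC subrK.
  have Zv := qf_young v pZ hP hQ PQ e0.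
  have -> : qf W v = (1 + e) * qf (P *m Z *m P) v + (1 + e^-1) * (z * qf Q v).
    by rewrite -qP mulrA -qfZ -qfD.
  apply: le_trans Zv _; rewrite lerD2l ler_wpM2l ?addr_ge0 ?invr_ge0 ?(ltW e0) //.
  by rewrite -qQ1 -{2}hQ.
have pW := pd_ge pZ hW ZW.
have WV : W *m V^t* = V^t* *m B.
  rewrite /W mulmxDl -scalemxAl QV scaler0 addr0.
  by rewrite -mulmxA VV mulmx1.
have := qle_cong V (opmon_qle mg pZ pW ZW).
rewrite -[V *m fcalc g W *m _]mulmxA (fcalc_intertwine g hW hB WV).
by rewrite mulmxA VV mul1mx.
Qed.

Lemma fcalc_scale k g c (A : 'M[C]_k) : herm A ->
  fcalc g (c%:C *: A) = fcalc (fun x => g (c * x)) A.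
Proof.
by move=> hA; rewrite -[in LHS](fcalc_id hA) -fcalcZ fcalc_comp.
Qed.

(** If the t_j sum to 1, the row of their square roots is a coisometry; compression by it turns a
    diagonal matrix into a convex combination, which brings the matrix inequality down to
    scalars. *)
Lemma qf_row_ediag k (t d : 'I_k -> R) : (forall j, 0 <= t j) ->
  let V := \row_j ((Num.sqrt (t j))%:C : C) in
  V *m ediag d *m V^t* = ((\sum_j t j * d j)%:C)%:M.
Proof.
move=> t0 /=; apply/matrixP => i j; rewrite !ord1 mxE [RHS]mxE eqxx mulr1n.
rewrite rmorph_sum /=; apply: eq_bigr => a _.
rewrite /ediag mul_mx_diag !mxE [Num.conj _]conjC_realc -!rmorphM /=.
by rewrite mulrAC -expr2 sqr_sqrtr.
Qed.

Lemma opmon_approx_concave g k (t d : 'I_k -> R) (e : R) :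
  operator_monotone g -> (forall j, 0 <= t j) -> (forall j, 0 < d j) ->
  \sum_j t j = 1 -> 0 < e ->
  \sum_j t j * g (d j) <= g ((1 + e) * \sum_j t j * d j).
Proof.
move=> mg t0 d0 t1 e0.
have pd : pdmx (ediag d) by exact: ediag_pd.
have VV := qf_row_ediag (fun=> 1) t0; rewrite /= in VV.
set V := \row_j _ in VV.
have V1 : V *m V^t* = 1%:M.
  have := VV; rewrite ediag_cst mulmx1 => ->.
  by under eq_bigr do rewrite mulr1; rewrite t1.
have := opmon_compress_approx mg V1 pd e0.
rewrite fcalc_ediag !qf_row_ediag // scale_scalar_mx -rmorphM fcalc_scalar.
by move/qle_scalar.
Qed.

End OperatorMonotone.

(** * Scalar consequences of operator monotonicity *)

(** This selects one perturbation parameter that serves all eigenvalues at once. *)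
Lemma finite_threshold (R : realType) k (Q : 'I_k -> R -> Prop) :
  (forall j, exists2 d, 0 < d & forall x, 0 < x -> x <= d -> Q j x) ->
  exists2 d, 0 < d & forall j, Q j d.
Proof.
move=> H; have /choice[d dP] : forall j, exists d,
    0 < d /\ forall x, 0 < x -> x <= d -> Q j x.
  by move=> j; have [d ? ?] := H j; exists d.
have m0 : 0 < \big[Num.min/1]_j d j.
  apply: (big_ind (fun x => 0 < x)) => // [x y x0 y0|j _]; last exact: (dP j).1.
  by rewrite lt_min x0 y0.
exists (\big[Num.min/1]_j d j) => // j; apply: (dP j).2 => //.
by rewrite (bigD1 j) //= ge_min lexx.
Qed.

Section ScalarOperatorMonotone.
Context {R : realType}.
Implicit Types (k p q : nat) (g : R -> R).
Local Notation C := R[i].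

Lemma opmon_approx_concave2 g (s x y e : R) :
  operator_monotone g -> 0 <= s <= 1 -> 0 < x -> 0 < y -> 0 < e ->
  s * g x + (1 - s) * g y <= g ((1 + e) * (s * x + (1 - s) * y)).
Proof.
move=> mg /andP[s0 s1] x0 y0 e0.
have := @opmon_approx_concave _ g 2 (fun j => if j == 0 then s else 1 - s)
  (fun j => if j == 0 then x else y) e mg.
rewrite !big_ord_recl !big_ord0 /= !addr0; apply => //.
- by move=> j; case: ifP => _ //; rewrite subr_ge0.
- by move=> j; case: ifP.
- by rewrite addrC subrK.
Qed.

(** Approximate concavity is applied between x / 2 and (1 + r / 4) x. The weight 1 / (1 + r) and the
    error r / (4 + 3 r) make the argument on the right exactly x, so that g ((1 + r / 4) x) - g x <=
    r (g x - g (x / 2)) <= e. *)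
Lemma opmon_right_continuous g (x e : R) : operator_monotone g -> 0 < x -> 0 < e ->
  exists2 d, 0 < d & forall y, 0 < y -> y <= d -> g ((1 + y) * x) <= g x + e.
Proof.
move=> mg x0 e0.
have x2 : 0 < x / 2 by rewrite divr_gt0.
have D0 : 0 <= g x - g (x / 2).
  rewrite subr_ge0; apply: opmon_mono => //; lra.
set D := g x - g (x / 2) in D0.
set r := e / (1 + D).
have D1 : 0 < 1 + D by lra.
have r0 : 0 < r by rewrite divr_gt0.
have rD : r * D <= e.
  rewrite /r mulrAC ler_pdivrMr // ler_wpM2l ?ltW //; lra.
exists (r / 4); first by rewrite divr_gt0.
move=> y y0 yr.
have xy : 0 < (1 + r / 4) * x by rewrite mulr_gt0 //; lra.
apply: le_trans (_ : g ((1 + r / 4) * x) <= _).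
  apply: opmon_mono => //; first by rewrite mulr_gt0 //; lra.
  by rewrite ler_wpM2r ?(ltW x0) //; lra.
have r1 : 0 < 1 + r by lra.
have r4 : 0 < 4 + 3 * r by lra.
have := @opmon_approx_concave2 g (1 + r)^-1 ((1 + r / 4) * x) (x / 2) (r / (4 + 3 * r)) mg.
rewrite invr_ge0 (ltW r1) invf_le1 // lerDl (ltW r0) => /(_ isT xy x2).
rewrite divr_gt0 // => /(_ isT).
have -> : (1 + r / (4 + 3 * r)) * ((1 + r)^-1 * ((1 + r / 4) * x) +
    (1 - (1 + r)^-1) * (x / 2)) = x by field; lra.
have -> : (1 + r)^-1 * g ((1 + r / 4) * x) + (1 - (1 + r)^-1) * g (x / 2)
    = (g ((1 + r / 4) * x) + r * g (x / 2)) / (1 + r) by field; lra.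
rewrite ler_pdivrMr //; rewrite /D in rD; lra.
Qed.

(** Only the values of g at the finitely many eigenvalues of V Z V^H matter, so right continuity
    there removes the factor 1 + e of the approximate version. *)
Lemma opmon_compress g p q (V : 'M[C]_(p, q)) (Z : 'M[C]_q) :
  operator_monotone g -> V *m V^t* = 1%:M -> pdmx Z -> pdmx (V *m Z *m V^t*) ->
  qle (V *m fcalc g Z *m V^t*) (fcalc g (V *m Z *m V^t*)).
Proof.
move=> mg VV pZ pB v; set B := V *m Z *m V^t*; have hB := pd_herm pB.
apply/ler_addgt0Pr => e e0.
have v0 := qf1_ge0 v.
have e'0 : 0 < e / (1 + qf 1%:M v) by rewrite divr_gt0 //; lra.
set e' := e / _ in e'0.
have e'e : e' * qf 1%:M v <= e.
  by rewrite /e' mulrAC ler_pdivrMr ?ler_wpM2l ?(ltW e0) //; lra.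
have [d d0 dP] := @finite_threshold R p
  (fun j x => g ((1 + x) * eig B j) <= g (eig B j) + e')
  (fun j => opmon_right_continuous mg (eig_gt0 j pB) e'0).
apply: le_trans (opmon_compress_approx mg VV pZ d0 v) _.
rewrite fcalc_scale //.
have /(_ v) := @fcalc_qle _ _ (fun x => g ((1 + d) * x)) (fun x => g x + e') B dP.
rewrite fcalcD fcalc_cst qfD qf_scalar => h; apply: le_trans h _.
by rewrite lerD2l.
Qed.

Lemma opmon_concave g (s x y : R) :
  operator_monotone g -> 0 <= s <= 1 -> 0 < x -> 0 < y ->
  s * g x + (1 - s) * g y <= g (s * x + (1 - s) * y).
Proof.
move=> mg s01 x0 y0; apply/ler_addgt0Pr => e e0.
have z0 : 0 < s * x + (1 - s) * y by nra.
have [d d0 dP] := opmon_right_continuous mg z0 e0.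
apply: le_trans (opmon_approx_concave2 mg s01 x0 y0 d0) _.
exact: dP.
Qed.

(** By concavity g x <= g (1 + u (x - 1)) / u for 0 < u <= 1, and the right-hand side tends to x - 1
    as u tends to 0. *)
Lemma opmonL_le_sub1 g x : opmonL g -> 0 < x -> g x <= x - 1.
Proof.
case=> mg g1 dg x0.
have [->|x1] := eqVneq x 1; first by rewrite g1 subrr.
have /cvgrPdist_lt cv : h^-1 *: ((g \o shift 1) (h *: 1) - g 1) @[h --> 0^'] --> (1 : R).
  by rewrite -[X in _ --> X](@derive_val _ _ _ _ _ _ _ dg); exact: ex_derive.
apply/ler_addgt0Pr => e e0.
have x10 : 0 < `|x - 1| by rewrite normr_gt0 subr_eq0.
have := cv (e / `|x - 1|); rewrite divr_gt0 // => /(_ isT).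
case/nbhs_ballP => d /= d0 dP.
(* The bound 1 makes u a convex weight; the other bound puts u (x - 1) inside the ball of radius
   d. *)
set u := Num.min 1 (d / 2 / `|x - 1|).
have u0 : 0 < u by rewrite lt_min ltr01 !divr_gt0.
have u1 : 0 <= u <= 1 by rewrite (ltW u0) ge_min lexx.
have ux : u * `|x - 1| <= d / 2.
  rewrite -ler_pdivlMr // ge_min lexx orbT //.
have := dP (u * (x - 1)); rewrite /ball /= sub0r normrN normrM gtr0_norm //.
have ud : u * `|x - 1| < d by lra.
have ux0 : u * (x - 1) != 0.
  by apply: mulf_neq0; [rewrite gt_eqF|rewrite subr_eq0].
move=> /(_ ud ux0).
rewrite g1 subr0 -[_%:A]/(_ * 1) mulr1 -[_ *: g _]/(_ * g _).
have := opmon_concave mg u1 x0 ltr01; rewrite g1 mulr0 addr0.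
have -> : u * x + (1 - u) * 1 = u * (x - 1) + 1 by ring.
move=> gu gd.
have : `|u * (x - 1) - g (u * (x - 1) + 1)| < e * u.
  have -> : u * (x - 1) - g (u * (x - 1) + 1) =
      (u * (x - 1)) * (1 - (u * (x - 1))^-1 * g (u * (x - 1) + 1)).
    by rewrite [RHS]mulrBr [X in _ = X - _]mulr1 mulVKf.
  rewrite normrM normrM (gtr0_norm u0) -mulrA [e * u]mulrC ltr_pM2l //.
  by rewrite mulrC -ltr_pdivlMr.
rewrite ltr_norml => /andP[h1 h2].
have : u * g x <= u * (x - 1 + e) by lra.
by rewrite ler_pM2l.
Qed.

Definition opdual g (x : R) : R := - g x^-1.

(** Inversion and negation both reverse the order, and the two factors -1 in the derivative cancel.
    This duality converts upper bounds into lower bounds and statements to the right of a point into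
    statements to its left. *)
Lemma opmonL_dual g : opmonL g -> opmonL (opdual g).
Proof.
case=> mg g1 dg; split; last 1 first.
- have dV : is_derive (1 : R) (1 : R) (fun y : R => y^-1) (- 1).
    have := @is_deriveV R id 1 1 1 (oner_neq0 _) (is_derive_id _ _).
    by rewrite /= expr1n invr1 scaleN1r.
  have dg' : is_derive ((1 : R)^-1) (1 : R) g 1 by rewrite invr1.
  have := is_deriveN (is_derive1_comp dg' dV).
  by rewrite mulrN1 opprK.
- move=> k A B pA pB AB.
  have E (X : 'M[C]_k) : fcalc (opdual g) X = - fcalc g (minv X).
    by rewrite /minv fcalc_comp -fcalcN.
  have -> : fun_mx (opdual g) A = fcalc (opdual g) A by rewrite fcalc.unlock.
  have -> : fun_mx (opdual g) B = fcalc (opdual g) B by rewrite fcalc.unlock.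
  apply/loewnerP => [||v]; try exact: fcalc_herm.
  rewrite !E (qfN (fcalc _ (minv A))) (qfN (fcalc _ (minv B))) lerN2.
  have := minv_qle pA pB (loewner_qle AB).
  by move/(opmon_qle mg (minv_pd pB) (minv_pd pA)); apply.
- by rewrite /opdual invr1 g1 oppr0.
Qed.

Lemma opmonL_ge_sub1V g x : opmonL g -> 0 < x -> 1 - x^-1 <= g x.
Proof.
move=> Lg x0; have := @opmonL_le_sub1 _ x^-1 (opmonL_dual Lg).
rewrite /opdual invrK invr_gt0 => /(_ x0); lra.
Qed.

(** When x lies beyond b, the point b is a convex combination of a and x, and concavity with g a = g
    b forces g x <= g a. *)
Lemma opmon_eq_after g a b x : operator_monotone g -> 0 < a -> a < b ->
  g a = g b -> a <= x -> g x = g a.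
Proof.
move=> mg a0 ab gab ax; apply/eqP; rewrite eq_le (opmon_mono mg a0 ax) andbT.
have [xb|bx] := leP x b.
  by rewrite gab; apply: opmon_mono => //; exact: lt_le_trans ax.
have xa : 0 < x - a by lra.
set s := (b - a) / (x - a).
have sx : s * (x - a) = b - a by rewrite /s mulfVK // gt_eqF.
have s0 : 0 < s by rewrite divr_gt0 // subr_gt0.
have s1 : 0 <= s <= 1 by rewrite (ltW s0) ler_pdivrMr //; lra.
have := @opmon_concave g s x a mg s1 _ a0.
have -> : s * x + (1 - s) * a = b by lra.
rewrite -gab => /(_ _) h.
have : s * g x <= s * g a by have := h (lt_le_trans a0 ax); lra.
by rewrite ler_pM2l.
Qed.

(** Equal values at x and y make g constant to the right of x, and by duality to the left of y as
    well. A constant g contradicts g 1 = 0 and g 2 >= 1/2. *)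
Lemma opmonL_strict g x y : opmonL g -> 0 < x -> x < y -> g x < g y.
Proof.
move=> Lg x0 xy; have [mg g1 _] := Lg; have [md _ _] := opmonL_dual Lg.
have y0 : 0 < y by exact: lt_trans xy.
rewrite lt_def (opmon_mono mg x0 (ltW xy)) andbT; apply/negP => /eqP e.
have cst z : x <= z -> g z = g x by move=> xz; apply: (opmon_eq_after mg x0 xy).
have cst2 z : 0 < z -> g z = g x.
  move=> z0; have [xz|zx] := leP x z; first exact: cst.
  have := @opmon_eq_after (opdual g) y^-1 x^-1 z^-1 md.
  rewrite /opdual !invrK invr_gt0 ltf_pV2 ?posrE // e => /(_ y0 xy erefl).
  rewrite lef_pV2 ?posrE // => /(_ _)/oppr_inj; apply.
  by rewrite (le_trans (ltW zx)) // ltW.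
have := @opmonL_ge_sub1V g 2 Lg; rewrite (cst2 2) // -(cst2 1) // g1.
by move=> /(_ _); lra.
Qed.

(** By concavity the chord slope on [x, x + u] is at most the slope from a / 2 to x + u. The latter
    is bounded using g y <= y - 1 and y - a / 2 >= a / 2. *)
Lemma opmonL_lipschitz g a : opmonL g -> 0 < a ->
  exists2 L : R, 0 < L & forall x u, a <= x -> 0 <= u -> g (x + u) <= g x + L * u.
Proof.
move=> Lg a0; have [mg g1 _] := Lg.
have a2 : 0 < a / 2 by lra.
have ga := opmonL_le_sub1 Lg a2.
set c := g (a / 2) in ga *.
exists (1 + (a / 2 - 1 - c) / (a / 2)).
  by rewrite ltr_pwDl // divr_ge0 //; lra.
move=> x u ax u0.
have y0 : 0 < x + u - a / 2 by lra.
set s := (x - a / 2) / (x + u - a / 2).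
have sy : s * (x + u - a / 2) = x - a / 2 by rewrite /s mulfVK // gt_eqF.
have s1 : 0 <= s <= 1.
  by apply/andP; split; [rewrite divr_ge0|rewrite ler_pdivrMr]; lra.
have xu0 : 0 < x + u by lra.
have := opmon_concave mg s1 xu0 a2.
have -> : s * (x + u) + (1 - s) * (a / 2) = x by lra.
have gy := opmonL_le_sub1 Lg xu0; rewrite -/c => h.
set y := x + u in gy h y0 sy *.
have us : (1 - s) * (y - a / 2) = u by rewrite /y in sy *; lra.
set t := 1 - s in us; have t0 : 0 <= t by rewrite /t; lra.
suff : t * (g y - c) <= (1 + (a / 2 - 1 - c) / (a / 2)) * u.
  by rewrite /t; lra.
apply: le_trans (_ : t * (y - a / 2 + (a / 2 - 1 - c)) <= _).
  by rewrite ler_wpM2l //; lra.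
set q := (a / 2 - 1 - c) / (a / 2).
have q0 : 0 <= q by rewrite divr_ge0 //; lra.
have -> : a / 2 - 1 - c = q * (a / 2) by rewrite mulfVK // gt_eqF.
have ya : 0 <= y - a by rewrite /y; lra.
have : 0 <= q * (t * (y - a)) by apply: mulr_ge0 => //; exact: mulr_ge0.
by rewrite -us; lra.
Qed.

End ScalarOperatorMonotone.

(** * Perspectives *)

(** The noncommutative perspective of g. Congruence by X^1/2 makes the terms of the Karcher equation
    homogeneous in the pair (X, A), so that they can be compared for different X. *)
HB.lock Definition persp (R : realType) (g : R -> R) k (X A : 'M[R[i]]_k) :
    'M[R[i]]_k :=
  msqrt X *m fcalc g (mrsqrt X *m A *m mrsqrt X) *m msqrt X.

Section Perspective.
Context {R : realType}.
Implicit Types (k p q : nat) (g : R -> R).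
Local Notation C := R[i].

Lemma qf_block k p (Z1 : 'M[C]_k) (Z2 : 'M[C]_p) v :
  qf (block_mx Z1 0 0 Z2) v = qf Z1 (lsubmx v) + qf Z2 (rsubmx v).
Proof.
rewrite -{1}[v]hsubmxK; move: (lsubmx v) (rsubmx v) => v1 v2.
rewrite qf.unlock mul_row_block !mulmx0 addr0 add0r tr_row_mx map_col_mx mul_row_col.
by rewrite mxE ReD.
Qed.

(** The row (K1 K2) is a coisometry that compresses the block diagonal matrix with blocks Z1 and
    Z2. *)
Lemma opmon_compress2 g k (Z1 Z2 K1 K2 : 'M[C]_k) :
  operator_monotone g -> pdmx Z1 -> pdmx Z2 ->
  K1 *m K1^t* + K2 *m K2^t* = 1%:M ->
  pdmx (K1 *m Z1 *m K1^t* + K2 *m Z2 *m K2^t*) ->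
  qle (K1 *m fcalc g Z1 *m K1^t* + K2 *m fcalc g Z2 *m K2^t*)
      (fcalc g (K1 *m Z1 *m K1^t* + K2 *m Z2 *m K2^t*)).
Proof.
move=> mg p1 p2 KK pZ.
have h1 := pd_herm p1; have h2 := pd_herm p2.
set V := row_mx K1 K2; set W := block_mx Z1 0 0 Z2.
have VE : V^t* = col_mx (K1^t*) (K2^t*) by rewrite tr_row_mx map_col_mx.
have hW : herm W by rewrite /herm /W tr_block_mx map_block_mx !trmx0 !map_mx0 h1 h2.
have pW : pdmx W.
  apply/pdmxP; split=> // v v0; rewrite qf_block.
  have [v10|v10] := eqVneq (lsubmx v) 0; last first.
    by rewrite ltr_pwDl ?pd_qf ?pd_qf_ge0.
  have v20 : rsubmx v != 0.
    by apply: contra v0 => /eqP v20; rewrite -[v]hsubmxK v10 v20 row_mx0.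
  by rewrite v10 qf0r add0r pd_qf.
have gWE : fcalc g W = block_mx (fcalc g Z1) 0 0 (fcalc g Z2).
  (* The coordinate embeddings intertwine W with its blocks, which determines both block columns of
     [fcalc g W]. *)
  have i1 : W *m col_mx 1%:M 0 = col_mx 1%:M 0 *m Z1.
    by rewrite mul_block_col mul_col_mx !mulmx1 !mul0mx !mulmx0 mul1mx !addr0.
  have i2 : W *m col_mx 0 1%:M = col_mx 0 1%:M *m Z2.
    by rewrite mul_block_col mul_col_mx !mulmx1 !mul0mx !mulmx0 mul1mx !add0r.
  have := fcalc_intertwine g hW h1 i1; have := fcalc_intertwine g hW h2 i2.
  rewrite -[fcalc g W]submxK; move: (ulsubmx _) (ursubmx _) (dlsubmx _) (drsubmx _).
  move=> a b c d; rewrite !mul_block_col !mul_col_mx !mulmx1 !mulmx0 !mul0mx !mul1mx.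
  by rewrite !addr0 !add0r => /eq_col_mx[-> ->] /eq_col_mx[-> ->].
have VWV (B1 B2 : 'M[C]_k) : V *m block_mx B1 0 0 B2 *m V^t* =
    K1 *m B1 *m K1^t* + K2 *m B2 *m K2^t*.
  by rewrite VE mul_row_block !mulmx0 addr0 add0r mul_row_col.
have VV : V *m V^t* = 1%:M by rewrite VE mul_row_col.
have := opmon_compress mg VV pW.
by rewrite gWE !VWV; exact.
Qed.

Lemma msqrt_cong k (X B : 'M[C]_k) : msqrt X *m B *m msqrt X = msqrt X *m B *m (msqrt X)^t*.
Proof. by rewrite (msqrt_herm X). Qed.

Lemma mrsqrt_cong k (X B : 'M[C]_k) :
  mrsqrt X *m B *m mrsqrt X = mrsqrt X *m B *m (mrsqrt X)^t*.
Proof. by rewrite (mrsqrt_herm X). Qed.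

Lemma perspE g k (X A : 'M[C]_k) :
  persp g X A = msqrt X *m fcalc g (mrsqrt X *m A *m mrsqrt X) *m msqrt X.
Proof. by rewrite persp.unlock. Qed.

Lemma persp_herm g k (X A : 'M[C]_k) : herm (persp g X A).
Proof. by rewrite perspE msqrt_cong; apply: herm_cong; exact: fcalc_herm. Qed.

Lemma mrsqrt_pd k (X A : 'M[C]_k) : pdmx X -> pdmx A ->
  pdmx (mrsqrt X *m A *m mrsqrt X).
Proof.
move=> pX pA; rewrite mrsqrt_cong; apply: pd_cong => //; exact: mrsqrt_msqrt.
Qed.

Lemma mrsqrt_self k (X : 'M[C]_k) : pdmx X -> mrsqrt X *m X *m mrsqrt X = 1%:M.
Proof.
move=> pX; rewrite -{2}(msqrtK pX) mulmxA mrsqrt_msqrt // mul1mx.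
exact: msqrt_mrsqrt.
Qed.

Lemma msqrt_self k (X : 'M[C]_k) : pdmx X -> msqrt X *m 1%:M *m msqrt X = X.
Proof. by move=> pX; rewrite mulmx1 msqrtK. Qed.

Lemma persp_qle g k (X A B : 'M[C]_k) : operator_monotone g ->
  pdmx X -> pdmx A -> pdmx B -> qle A B -> qle (persp g X A) (persp g X B).
Proof.
move=> mg pX pA pB AB; rewrite !perspE !msqrt_cong; apply: qle_cong.
apply: (opmon_qle mg (mrsqrt_pd pX pA) (mrsqrt_pd pX pB)).
by rewrite !mrsqrt_cong; exact: qle_cong.
Qed.

Lemma persp_scale g k (c : R) (X A : 'M[C]_k) : 0 < c -> herm X ->
  persp g (c%:C *: X) (c%:C *: A) = c%:C *: persp g X A.
Proof.
move=> c0 hX; set s := Num.sqrt c.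
have s0 : s != 0 by rewrite gt_eqF // sqrtr_gt0.
have ss : s * s = c by rewrite -expr2 sqr_sqrtr // ltW.
have E1 : msqrt (c%:C *: X) = s%:C *: msqrt X.
  rewrite /msqrt fcalc_scale // -fcalcZ; apply: eq_fcalc => j.
  by rewrite sqrtrM // ltW.
have E2 : mrsqrt (c%:C *: X) = (s^-1)%:C *: mrsqrt X.
  rewrite /mrsqrt fcalc_scale // -fcalcZ; apply: eq_fcalc => j.
  by rewrite sqrtrM ?invfM // ltW.
rewrite !perspE E1 E2 -!scalemxAl -!scalemxAr !scalerA -!scalemxAl scalerA -!rmorphM.
have -> : s^-1 / s * c = 1 by rewrite -ss mulrACA mulVf // mulr1.
by rewrite ss rmorph1 scale1r.
Qed.

Lemma persp_shift g k t (X A : 'M[C]_k) : pdmx X -> herm A ->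
  persp g X (A + t%:C *: X) =
  msqrt X *m fcalc (fun x => g (x + t)) (mrsqrt X *m A *m mrsqrt X) *m msqrt X.
Proof.
move=> pX hA; rewrite perspE mulmxDr mulmxDl -scalemxAr -scalemxAl mrsqrt_self //.
set Z := _ *m A *m _; have hZ : herm Z by rewrite /Z mrsqrt_cong; exact: herm_cong.
by rewrite scalemx1 -{1}(fcalc_id hZ) -(fcalc_cst t Z) -fcalcD fcalc_comp.
Qed.

(* Jensen's inequality for the isometry (C, D) with C = Y^-1/2 X^1/2. *)
Lemma persp_jensen g k t (X Y A : 'M[C]_k) : operator_monotone g ->
  pdmx X -> pdmx Y -> pdmx A -> 0 < t -> qle X Y ->
  qle (persp g X A + (g t)%:C *: (Y - X)) (persp g Y (A + t%:C *: (Y - X))).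
Proof.
move=> mg pX pY pA t0 XY.
have hX := pd_herm pX; have hY := pd_herm pY; have hA := pd_herm pA.
set S := msqrt Y; set S' := mrsqrt Y; set T := msqrt X; set T' := mrsqrt X.
have hS : S^t* = S by exact: msqrt_herm.
have hS' : S'^t* = S' by exact: mrsqrt_herm.
have hT : T^t* = T by exact: msqrt_herm.
have SS' : S *m S' = 1%:M by exact: msqrt_mrsqrt.
have S'S : S' *m S = 1%:M by exact: mrsqrt_msqrt.
have TT' : T *m T' = 1%:M by exact: msqrt_mrsqrt.
have T'T : T' *m T = 1%:M by exact: mrsqrt_msqrt.
have TT : T *m T = X by exact: msqrtK.
(* This is the defect 1 - K K^H of K = Y^-1/2 X^1/2, nonnegative because X <= Y. Its square root
   completes K to a coisometry, and Y^1/2 E Y^1/2 = Y - X produces the correction term. *)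
set E := 1%:M - S' *m X *m S'.
have hE : herm E.
  by apply: hermB; [exact: herm1|rewrite /S' mrsqrt_cong; exact: herm_cong].
have E0 v : 0 <= qf E v.
  rewrite qfB subr_ge0 -(mrsqrt_self pY) -/S' /S' !mrsqrt_cong.
  exact: qle_cong.
set D := msqrt E; have hD : D^t* = D by exact: msqrt_herm.
have DD : D *m D = E by exact: psd_sqrt.
set K := S' *m T.
have hK : K^t* = T *m S' by rewrite adjmxM hT hS'.
have KK : K *m K^t* + D *m D^t* = 1%:M.
  by rewrite hK hD DD /K !mulmxA -[S' *m T *m T]mulmxA TT /E addrC subrK.
have pZ : pdmx (T' *m A *m T') by exact: mrsqrt_pd.
have pt : pdmx ((t%:C)%:M : 'M[C]_k) by exact: pd_scalar.
have SES : S *m E *m S = Y - X.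
  rewrite /E mulmxBr mulmxBl (msqrt_self pY) !mulmxA SS' mul1mx -mulmxA S'S.
  by rewrite mulmx1.
have KZK : K *m (T' *m A *m T') *m K^t* + D *m (t%:C)%:M *m D^t* =
    S' *m (A + t%:C *: (Y - X)) *m S'.
  rewrite hD hK /K !mulmxA -[S' *m T *m T']mulmxA TT' mulmx1.
  rewrite -[_ *m T' *m T]mulmxA T'T mulmx1 mul_mx_scalar -scalemxAl DD.
  rewrite mulmxDr mulmxDl -scalemxAr -scalemxAl -SES; congr (_ + _ *: _).
  by rewrite !mulmxA S'S mul1mx -mulmxA SS' mulmx1.
have pB : pdmx (A + t%:C *: (Y - X)).
  apply: pdD => //; first by apply: hermZ; exact: hermB.
  by move=> v; rewrite qfZ qfB mulr_ge0 ?subr_ge0 // ltW.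
have := opmon_compress2 mg pZ pt KK.
rewrite KZK => /(_ (mrsqrt_pd pY pB)) /(qle_cong S).
rewrite fcalc_scalar hS [persp g Y _]perspE.
suff -> : S *m (K *m fcalc g (T' *m A *m T') *m K^t* + D *m ((g t)%:C)%:M *m D^t*) *m S
   = persp g X A + (g t)%:C *: (Y - X) by [].
rewrite mulmxDr mulmxDl hD mul_mx_scalar -scalemxAl -scalemxAr -scalemxAl DD SES.
congr (_ + _); rewrite hK /K perspE -/T -/T' !mulmxA SS' mul1mx.
by rewrite -mulmxA S'S mulmx1.
Qed.

Lemma mrsqrt_lower k a (X A : 'M[C]_k) j : pdmx X -> herm A -> qle (a%:C *: X) A ->
  a <= eig (mrsqrt X *m A *m mrsqrt X) j.
Proof.
move=> pX hA aX; apply: eig_ge.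
  by rewrite mrsqrt_cong; exact: herm_cong.
have -> : (a%:C)%:M = mrsqrt X *m (a%:C *: X) *m mrsqrt X.
  by rewrite -scalemxAr -scalemxAl mrsqrt_self // scalemx1.
by rewrite !mrsqrt_cong; exact: qle_cong.
Qed.

(** The spectrum of X^-1/2 A X^-1/2 lies above a, where the scalar bound applies. The constant
    depends on g and a alone, so it is uniform along a sequence of matrices. *)
Lemma persp_lipschitz g a : opmonL g -> 0 < a ->
  exists2 L : R, 0 < L & forall k (X A : 'M[C]_k) (u : R), pdmx X -> herm A ->
    qle (a%:C *: X) A -> 0 <= u ->
    qle (persp g X (A + u%:C *: X)) (persp g X A + (L * u)%:C *: X).
Proof.
move=> Lg a0; have [L L0 LP] := opmonL_lipschitz Lg a0.
exists L => // k X A u pX hA aX u0; rewrite persp_shift //.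
have -> : persp g X A + (L * u)%:C *: X = msqrt X *m
    fcalc (fun x => g x + L * u) (mrsqrt X *m A *m mrsqrt X) *m msqrt X.
  rewrite perspE fcalcD fcalc_cst mulmxDr mulmxDl; congr (_ + _).
  by rewrite mul_mx_scalar -scalemxAl msqrtK.
rewrite !msqrt_cong; apply: qle_cong; apply: fcalc_qle => j.
apply: LP => //; exact: mrsqrt_lower.
Qed.

Lemma msqrt_pd k (X B : 'M[C]_k) : pdmx X -> pdmx B -> pdmx (msqrt X *m B *m msqrt X).
Proof.
move=> pX pB; rewrite msqrt_cong; apply: pd_cong => //; exact: msqrt_mrsqrt.
Qed.

Lemma pd_lower_mul k (X A : 'M[C]_k) : pdmx X -> pdmx A ->
  exists2 a : R, 0 < a & qle (a%:C *: X) A.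
Proof.
move=> pX pA; have [a a0 aA] := pd_lower pA.
have [c c0 Xc] := herm_upper (pd_herm pX).
exists (a / c); first by rewrite divr_gt0.
move=> v; rewrite qfZ; apply: le_trans (aA v).
rewrite mulrAC ler_pdivrMr // qf_scalar -mulrA ler_wpM2l ?(ltW a0) //.
by rewrite mulrC -qf_scalar.
Qed.

Lemma persp_strict g k (l : R) (X A : 'M[C]_k) : opmonL g -> pdmx X -> pdmx A -> 1 < l ->
  exists2 s : R, 0 < s &
    pdmx (persp g X A - persp g X ((l^-1)%:C *: A + s%:C *: X)).
Proof.
move=> Lg pX pA l1; have [a a0 aX] := pd_lower_mul pX pA.
have l0 : 0 < l by lra.
have li : l^-1 < 1 by rewrite invf_lt1.
have li0 : 0 < l^-1 by rewrite invr_gt0.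
(* An eigenvalue z >= a of X^-1/2 A X^-1/2 exceeds z / l by at least (1 - 1/l) a; s is half of this
   gap. *)
have s0 : 0 < (1 - l^-1) * a / 2 by rewrite divr_gt0 // mulr_gt0 //; lra.
set s := (1 - l^-1) * a / 2 in s0; exists s; first exact: s0.
have hA := pd_herm pA.
rewrite (persp_shift g s pX (hermZ _ hA)).
set Z := mrsqrt X *m A *m mrsqrt X.
have pZ : pdmx Z by exact: mrsqrt_pd.
have -> : mrsqrt X *m ((l^-1)%:C *: A) *m mrsqrt X = (l^-1)%:C *: Z.
  by rewrite -scalemxAr -scalemxAl.
rewrite fcalc_scale; last exact: pd_herm.
have -> : persp g X A - msqrt X *m fcalc (fun x => g (l^-1 * x + s)) Z *m msqrt X =
   msqrt X *m fcalc (fun x => g x - g (l^-1 * x + s)) Z *m msqrt X.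
  by rewrite perspE fcalcD fcalcN mulmxBr mulmxBl.
apply: (msqrt_pd pX); apply: fcalc_pd => j; rewrite subr_gt0.
have aj : a <= eig Z j by exact: mrsqrt_lower.
have : 0 < l^-1 * eig Z j by rewrite mulr_gt0 // (lt_le_trans a0).
have : (1 - l^-1) * a <= (1 - l^-1) * eig Z j by rewrite ler_wpM2l //; lra.
by move=> h1 h2; apply: opmonL_strict => //; move: s0; rewrite /s; lra.
Qed.

Lemma scale_realA k (a b : R) (X : 'M[C]_k) :
  a%:C *: (b%:C *: X) = (a * b)%:C *: X.
Proof. by rewrite scalerA -rmorphM. Qed.

(** In the perspective inequality for Y <= l X the correction g(s) (l X - Y) vanishes at v.
    Homogeneity rewrites the right-hand side as l P(X, A / l + s X), which lies strictly below l
    P(X, A). *)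
Lemma persp_lt_eigenvector g k (l : R) (X Y A : 'M[C]_k) (v : 'rV[C]_k) :
  opmonL g -> pdmx X -> pdmx Y -> pdmx A -> 1 < l -> v != 0 ->
  qle Y (l%:C *: X) -> qf Y v = l * qf X v ->
  qf (persp g Y A) v < l * qf (persp g X A) v.
Proof.
move=> Lg pX pY pA l1 v0 YlX Yv; have [mg _ _] := Lg.
have l0 : 0 < l by exact: lt_trans l1.
have plX : pdmx (l%:C *: X) by exact: pdZ.
have [s s0 /pd_qf-/(_ v v0)] := persp_strict Lg pX pA l1.
rewrite qfB subr_gt0 -(ltr_pM2l l0); apply: le_lt_trans.
have psY : pdmx (s%:C *: Y) by exact: pdZ.
have pAs : pdmx (A + s%:C *: Y).
  by apply: (pdD pA (pd_herm psY)) => u; exact: pd_qf_ge0.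
have AAs : qle A (A + s%:C *: Y).
  by move=> u; rewrite qfD lerDl; exact: pd_qf_ge0.
apply: le_trans (persp_qle mg pY pA pAs AAs v) _.
have := persp_jensen mg pY plX pAs s0 YlX v.
rewrite qfD [qf (_ *: (_ - _)) _]qfZ qfB qfZ Yv subrr mulr0 addr0.
suff -> : A + s%:C *: Y + s%:C *: (l%:C *: X - Y) =
    l%:C *: ((l^-1)%:C *: A + s%:C *: X).
  by rewrite (persp_scale _ _ l0 (pd_herm pX)) qfZ.
rewrite [RHS]scalerDr !scale_realA mulfV ?gt_eqF // scale1r scalerBr scale_realA.
by rewrite -addrA [_ + (_ - _)]addrC subrK mulrC.
Qed.

Lemma karcher_comparison g k n (w : 'I_n -> R) (A : 'I_n -> 'M[C]_k) X Y :
  opmonL g -> weight_vector w -> (forall i, pdmx (A i)) -> pdmx X -> pdmx Y ->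
  (forall v, 0 <= qf (\sum_i (w i)%:C *: persp g Y (A i)) v) ->
  (forall v, qf (\sum_i (w i)%:C *: persp g X (A i)) v <= 0) ->
  qle Y X.
Proof.
move=> Lg [w0 w1] pA pX pY GY GX; have [mg g1 _] := Lg.
apply: contrapT => /(not_qle_eigenvector pX (pd_herm pY))[l [v [l1 v0 YlX Yv]]].
have l0 : 0 < l by lra.
have plX : pdmx (l%:C *: X) by exact: pdZ.
have lt_i i : qf (persp g Y (A i)) v < l * qf (persp g X (A i)) v.
  exact: (persp_lt_eigenvector Lg pX pY (pA i) l1 v0 YlX Yv).
(* The weights sum to 1, so some index exists and the strict inequality survives summation. *)
have [i0 _|n0] := pickP 'I_n; last first.
  by move: w1; rewrite big1 => [/esym/eqP|i]; [rewrite oner_eq0|have := n0 i].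
have : qf (\sum_i (w i)%:C *: persp g Y (A i)) v <
    l * qf (\sum_i (w i)%:C *: persp g X (A i)) v.
  rewrite !qf_sum mulr_sumr (bigD1 i0) //= [X in _ < X](bigD1 i0) //=.
  have aux i : qf ((w i)%:C *: persp g Y (A i)) v <
      l * qf ((w i)%:C *: persp g X (A i)) v.
    by rewrite !qfZ mulrCA ltr_pM2l.
  by apply: ltr_leD => //; apply: ler_sum => i _; exact: ltW.
move=> h; have := le_lt_trans (GY v) h; rewrite pmulr_rgt0 // => /lt_le_trans.
by move=> /(_ _ (GX v)); rewrite ltxx.
Qed.

End Perspective.

(** * Monotone limits in the Loewner order *)

Section MonotoneLimit.
Context {R : realType}.
Implicit Types (k p q : nat) (g : R -> R).
Local Notation C := R[i].

Definition mtr k (A : 'M[C]_k) : R := complex.Re (\tr A).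

Lemma mtrD k (A B : 'M[C]_k) : mtr (A + B) = mtr A + mtr B.
Proof. by rewrite /mtr mxtraceD ReD. Qed.

Lemma mtrN k (A : 'M[C]_k) : mtr (- A) = - mtr A.
Proof. by rewrite /mtr raddfN ReN. Qed.

Lemma mtrZ k c (A : 'M[C]_k) : mtr (c%:C *: A) = c * mtr A.
Proof. by rewrite /mtr mxtraceZ ReZ. Qed.

Lemma delta_form k (A : 'M[C]_k) a b :
  ((delta_mx 0 a : 'rV_k) *m A *m (delta_mx 0 b : 'rV_k)^t*) 0 0 = A a b.
Proof. by rewrite -rowE trmx_delta map_delta_mx -colE !mxE. Qed.

Lemma mtrE k (A : 'M[C]_k) : mtr A = \sum_a qf A (delta_mx 0 a).
Proof.
rewrite /mtr /mxtrace Re_sum; apply: eq_bigr => a _.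
by rewrite qf.unlock delta_form.
Qed.

Lemma mtr_qle k (A B : 'M[C]_k) : qle A B -> mtr A <= mtr B.
Proof. by move=> AB; rewrite !mtrE; apply: ler_sum => a _; exact: AB. Qed.

Lemma mtr_eig k (A : 'M[C]_k) : herm A -> mtr A = \sum_j eig A j.
Proof.
move=> hA; rewrite /mtr {1}(spectralE hA) -mulmxA mxtrace_mulC -mulmxA eigvecsKV.
rewrite mulmx1 /ediag mxtrace_diag Re_sum; apply: eq_bigr => j _.
by rewrite mxE.
Qed.

Lemma psd_le_mtr k (A : 'M[C]_k) : herm A -> (forall v, 0 <= qf A v) ->
  qle A ((mtr A)%:C)%:M.
Proof.
move=> hA A0; rewrite -(fcalc_cst _ A) -{1}(fcalc_id hA).
apply: fcalc_qle => j; rewrite mtr_eig // (bigD1 j) //= lerDl.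
apply: sumr_ge0 => i _; have [<- _] := qf_eig i hA; exact: A0.
Qed.

Lemma qf_entries k (A : 'M[C]_k) v : qf A v = \sum_a \sum_b
  (complex.Re (v 0 a * Num.conj (v 0 b)) * complex.Re (A a b)
   - complex.Im (v 0 a * Num.conj (v 0 b)) * complex.Im (A a b)).
Proof.
rewrite qf.unlock mxE Re_sum exchange_big; apply: eq_bigr => b _.
rewrite mxE mulr_suml Re_sum; apply: eq_bigr => a _.
rewrite !mxE mulrAC; move: (v 0 a * _) (A a b) => [x1 x2] [y1 y2].
by [].
Qed.

Lemma hermE k (A : 'M[C]_k) a b : herm A -> A b a = Num.conj (A a b).
Proof. by move=> hA; rewrite -{1}hA !mxE. Qed.

Lemma Re_conj (z : C) : complex.Re (Num.conj z) = complex.Re z.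
Proof. by case: z. Qed.

Lemma Im_conj (z : C) : complex.Im (Num.conj z) = - complex.Im z.
Proof. by case: z. Qed.

Lemma qf_add k (A : 'M[C]_k) u v : qf A (u + v) = qf A u + qf A v +
  (complex.Re ((u *m A *m v^t*) 0 0) + complex.Re ((v *m A *m u^t*) 0 0)).
Proof.
rewrite !qf.unlock adjmxD mulmxDl mulmxDr !mulmxDl.
move: (u *m A *m u^t*) (v *m A *m u^t*) (u *m A *m v^t*) (v *m A *m v^t*).
move=> a b c d; rewrite [in LHS]mxE [in X in X + _]mxE [in X in _ + X]mxE !ReD.
by move: (complex.Re _) (complex.Re _) (complex.Re _) (complex.Re _) => *; ring.
Qed.

Lemma adjmx_scale k p z (A : 'M[C]_(k, p)) : (z *: A)^t* = Num.conj z *: A^t*.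
Proof. by apply/matrixP => i j; rewrite !mxE rmorphM. Qed.

(** Polarization recovers the entries of a Hermitian matrix from its quadratic form, so convergence
    of forms yields convergence of entries. *)
Lemma polar_Re k (A : 'M[C]_k) a b : herm A -> complex.Re (A a b) =
  (qf A (delta_mx 0 a + delta_mx 0 b) - qf A (delta_mx 0 a) - qf A (delta_mx 0 b)) / 2.
Proof.
move=> hA; rewrite qf_add !delta_form (hermE a b hA) Re_conj.
by move: (qf _ _) (qf _ _) => x y; field.
Qed.

Lemma polar_Im k (A : 'M[C]_k) a b : herm A -> complex.Im (A a b) =
  (qf A (delta_mx 0 a + 'i%C *: delta_mx 0 b) - qf A (delta_mx 0 a)
   - qf A (delta_mx 0 b)) / 2.
Proof.
move=> hA; rewrite qf_add.
have -> : qf A ('i%C *: delta_mx 0 b) = qf A (delta_mx 0 b).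
  rewrite !qf.unlock adjmx_scale -!scalemxAl -!scalemxAr scalerA.
  rewrite (_ : 'i%C * Num.conj 'i%C = 1) ?scale1r //.
  apply/eqP; rewrite eq_complex /=.
  by rewrite !(mul0r, mul1r, mulr0, mulr1, subr0, addr0, oppr0, opprK, sub0r, add0r) !eqxx.
rewrite adjmx_scale -!scalemxAl -!scalemxAr [X in complex.Re X + _]mxE.
rewrite [X in _ + complex.Re X]mxE !delta_form (hermE a b hA).
move: (qf _ _) (qf _ _) (A a b) => x y [z1 z2] /=.
by rewrite !mul0r !mul1r; field.
Qed.

Lemma cvg_bigsum n (F : 'I_n -> R^nat) (l : 'I_n -> R) :
  (forall i, F i x @[x --> \oo] --> l i) ->
  \sum_i F i x @[x --> \oo] --> \sum_i l i.
Proof.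
move=> Fl; elim: (index_enum _) => [|i s IH].
  by under eq_fun do rewrite big_nil; rewrite big_nil; exact: cvg_cst.
by under eq_fun do rewrite big_cons; rewrite big_cons; exact: cvgD.
Qed.

(** The candidate limit is built by polarizing the limit of the forms. The entries then converge to
    it, and each form is a fixed linear expression in the entries. *)
Lemma qf_limit k (X_ : nat -> 'M[C]_k) : (forall j, herm (X_ j)) ->
  (forall v, cvgn (fun j => qf (X_ j) v)) ->
  exists2 X, herm X & forall v, qf (X_ j) v @[j --> \oo] --> qf X v.
Proof.
move=> hX cX.
pose q v := limn (fun j => qf (X_ j) v).
have qP v : qf (X_ j) v @[j --> \oo] --> q v by exact: cX.
pose e a : 'rV[C]_k := delta_mx 0 a.
pose X : 'M[C]_k := \matrix_(a, b)
  (((q (e a + e b) - q (e a) - q (e b)) / 2)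
   +i* ((q (e a + 'i%C *: e b) - q (e a) - q (e b)) / 2)).
have cR a b : complex.Re (X_ j a b) @[j --> \oo] --> complex.Re (X a b).
  under eq_fun do rewrite polar_Re //.
  by rewrite mxE /=; apply: cvgM; [apply: cvgB; [apply: cvgB|]|exact: cvg_cst].
have cI a b : complex.Im (X_ j a b) @[j --> \oo] --> complex.Im (X a b).
  under eq_fun do rewrite polar_Im //.
  by rewrite mxE /=; apply: cvgM; [apply: cvgB; [apply: cvgB|]|exact: cvg_cst].
exists X.
  apply/matrixP => a b; rewrite mxE [X^T _ _]mxE.
  have hR : complex.Re (X b a) = complex.Re (X a b).
    apply: (cvg_unique _ (cR b a)) => //.
    rewrite (_ : (fun j => _) = (fun j => complex.Re (X_ j a b))); first exact: cR.
    by apply/funext => j; rewrite (hermE a b (hX j)) Re_conj.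
  have hI : complex.Im (X b a) = - complex.Im (X a b).
    apply: (cvg_unique _ (cI b a)) => //.
    rewrite (_ : (fun j => _) = (fun j => - complex.Im (X_ j a b))).
      by apply: cvgN; exact: cI.
    by apply/funext => j; rewrite (hermE a b (hX j)) Im_conj.
  apply/eqP; rewrite eq_complex Re_conj Im_conj hR hI opprK !eqxx //.
move=> v; rewrite qf_entries; under eq_fun do rewrite qf_entries.
apply: cvg_bigsum => a; apply: cvg_bigsum => b.
by apply: cvgB; apply: cvgM => //; exact: cvg_cst.
Qed.

(** Each form is nonincreasing and bounded below. Uniformity in the vector comes from the trace: X_j
    - X is positive semidefinite, hence at most its trace times 1, and the traces converge. *)
Lemma loewner_monotone_limit k (X_ : nat -> 'M[C]_k) c :
  (forall j, herm (X_ j)) -> (forall j, qle (X_ j.+1) (X_ j)) ->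
  (forall j, qle (c%:C)%:M (X_ j)) ->
  exists X, [/\ herm X, qle (c%:C)%:M X, (forall j, qle X (X_ j)) &
    forall e, 0 < e -> exists N, forall j, (N <= j)%N ->
      qle (X_ j) (X + (e%:C)%:M)].
Proof.
move=> hX dX cX.
have ni v : nonincreasing_seq (fun j => qf (X_ j) v).
  by apply/nonincreasing_seqP => j; exact: dX.
have cvX v : cvgn (fun j => qf (X_ j) v).
  apply: nonincreasing_is_cvgn => //; exists (qf (c%:C)%:M v) => _ [j _ <-].
  exact: cX.
have [X hXX XP] := qf_limit hX cvX.
have XX j : qle X (X_ j).
  move=> v; rewrite -(cvg_lim _ (XP v)) //.
  exact: nonincreasing_cvgn_ge (ni v) (cvX v) j.
exists X; split=> // [v|e e0].
  rewrite -(cvg_lim _ (XP v)) //; apply: limr_ge; first exact: cvX.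
  by apply: nearW => j; exact: cX.
have : mtr (X_ j) @[j --> \oo] --> mtr X.
  rewrite mtrE; under eq_fun do rewrite mtrE.
  by apply: cvg_bigsum => a; exact: XP.
move/cvgrPdist_lt => /(_ e e0)[N _ NP]; exists N => j Nj v.
have := NP j Nj; rewrite /= distrC => /ltW/(le_trans (ler_norm _)) tj.
have hD : herm (X_ j - X) by exact: hermB.
have D0 u : 0 <= qf (X_ j - X) u by rewrite qfB subr_ge0; exact: XX.
have := psd_le_mtr hD D0 v.
rewrite qfB qfD (qf_scalar e) qf_scalar mtrD mtrN => h.
have := ler_wpM2r (qf1_ge0 v) tj; lra.
Qed.

End MonotoneLimit.

(** * Solutions of the Karcher equation *)

HB.lock Definition karcher_map (R : realType) (g : R -> R) n k (w : 'I_n -> R)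
    (A : 'I_n -> 'M[R[i]]_k) (t : R) (X : 'M[R[i]]_k) : 'M[R[i]]_k :=
  \sum_i (w i)%:C *: persp g X (A i + t%:C *: X).

HB.lock Definition karcher_step (R : realType) (g : R -> R) n k (w : 'I_n -> R)
    (A : 'I_n -> 'M[R[i]]_k) j (X : 'M[R[i]]_k) : 'M[R[i]]_k :=
  X + (j.+1%:R^-1)%:C *: karcher_map g w A (j.+2%:R^-1) X.

Section KarcherEquation.
Context {R : realType}.
Implicit Types (k n : nat) (g : R -> R).
Local Notation C := R[i].

Lemma karcher_map_herm g n k (w : 'I_n -> R) (A : 'I_n -> 'M[C]_k) t X :
  herm (karcher_map g w A t X).
Proof. by rewrite karcher_map.unlock; apply: herm_sum => i; apply: hermZ; exact: persp_herm. Qed.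

Lemma qf_karcher_map g n k (w : 'I_n -> R) (A : 'I_n -> 'M[C]_k) t X v :
  qf (karcher_map g w A t X) v =
  \sum_i w i * qf (persp g X (A i + t%:C *: X)) v.
Proof. by rewrite karcher_map.unlock qf_sum; apply: eq_bigr => i _; rewrite qfZ. Qed.

Lemma karcher_map0 g n k (w : 'I_n -> R) (A : 'I_n -> 'M[C]_k) X :
  karcher_map g w A 0 X = \sum_i (w i)%:C *: persp g X (A i).
Proof. by rewrite karcher_map.unlock; apply: eq_bigr => i _; rewrite scale0r addr0. Qed.

Lemma weighted_le n (w : 'I_n -> R) (a b : 'I_n -> R) c : weight_vector w ->
  (forall i, a i <= b i + c) ->
  \sum_i w i * a i <= \sum_i w i * b i + c.
Proof.
move=> [w0 w1] ab; rewrite -[c]mul1r -w1 mulr_suml -big_split /=.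
by apply: ler_sum => i _; rewrite -mulrDr ler_wpM2l // ltW.
Qed.

Lemma pd_shift k t (A X : 'M[C]_k) : pdmx A -> pdmx X -> 0 <= t ->
  pdmx (A + t%:C *: X).
Proof.
move=> pA pX t0; apply: pdD => // [|v]; first by apply: hermZ; exact: pd_herm.
by rewrite qfZ mulr_ge0 // pd_qf_ge0.
Qed.

Lemma persp_self g k (X : 'M[C]_k) : g 1 = 0 -> pdmx X -> persp g X X = 0.
Proof.
move=> g1 pX; rewrite perspE mrsqrt_self // -[1%:M]/((1%:C)%:M) fcalc_scalar g1.
by rewrite raddf0 mulmx0 mul0mx.
Qed.

Lemma karcher_map_qle g n k (w : 'I_n -> R) (A : 'I_n -> 'M[C]_k) s t X :
  operator_monotone g -> weight_vector w -> (forall i, pdmx (A i)) -> pdmx X ->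
  0 <= s -> s <= t -> qle (karcher_map g w A s X) (karcher_map g w A t X).
Proof.
move=> mg ww pA pX s0 st v; rewrite !qf_karcher_map.
rewrite -[X in _ <= X]addr0; apply: weighted_le => // i; rewrite addr0.
apply: (persp_qle mg pX (pd_shift (pA i) pX s0) (pd_shift (pA i) pX (le_trans s0 st))).
by move=> u; rewrite 2!qfD 2!qfZ lerD2l ler_wpM2r // pd_qf_ge0.
Qed.

(** The shift by t X is there so that A_i + t X + t (Y - X) = A_i + t Y: the perspective inequality
    then compares one and the same map at X and at Y. *)
Lemma karcher_map_jensen g n k (w : 'I_n -> R) (A : 'I_n -> 'M[C]_k) t X Y :
  operator_monotone g -> weight_vector w -> (forall i, pdmx (A i)) ->
  pdmx X -> pdmx Y -> 0 < t -> qle X Y ->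
  qle (karcher_map g w A t X) (karcher_map g w A t Y + (- g t)%:C *: (Y - X)).
Proof.
move=> mg ww pA pX pY t0 XY v; rewrite qfD qfZ !qf_karcher_map.
apply: weighted_le => // i.
have := persp_jensen mg pX pY (pd_shift (pA i) pX (ltW t0)) t0 XY v.
have -> : A i + t%:C *: X + t%:C *: (Y - X) = A i + t%:C *: Y.
  by rewrite -addrA -scalerDr [X + _]addrC subrK.
rewrite qfD [qf (_ *: (_ - _)) _]qfZ; lra.
Qed.

Lemma karcher_solutionP g n k (w : 'I_n -> R) (A : 'I_n -> 'M[C]_k) X :
  karcher_solution g w A X <->
  pdmx X /\ \sum_i (w i)%:C *: persp g X (A i) = 0.
Proof.
rewrite /karcher_solution /invsqrt_mx.
have -> : fun_mx (fun x : R => (Num.sqrt x)^-1) X = mrsqrt X.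
  by rewrite /mrsqrt fcalc.unlock.
have E : \sum_i (w i)%:C *: persp g X (A i) = msqrt X *m
    (\sum_i (w i)%:C *: fun_mx g (mrsqrt X *m A i *m mrsqrt X)) *m msqrt X.
  rewrite mulmx_sumr mulmx_suml; apply: eq_bigr => i _.
  by rewrite -scalemxAr -scalemxAl perspE fcalc.unlock.
rewrite E; split=> -[pX]; first by move=> ->; rewrite mulmx0 mul0mx.
move=> e0; split=> //; set S := \sum_i _ in e0 *.
have : mrsqrt X *m (msqrt X *m S *m msqrt X) *m mrsqrt X = S.
  rewrite !mulmxA mrsqrt_msqrt // mul1mx -mulmxA msqrt_mrsqrt // mulmx1 //.
by rewrite e0 mulmx0 mul0mx.
Qed.

Lemma qf_karcher_step g n k (w : 'I_n -> R) (A : 'I_n -> 'M[C]_k) j X v :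
  qf (karcher_step g w A j X) v =
  qf X v + j.+1%:R^-1 * qf (karcher_map g w A (j.+2%:R^-1) X) v.
Proof. by rewrite karcher_step.unlock qfD qfZ. Qed.

(** The first shift is t = 1/2, and A_i + (1/2) 2 M <= 2 M, so the map is nonpositive at the
    starting point 2 M. *)
Fixpoint karcher_iter g n k (w : 'I_n -> R) (A : 'I_n -> 'M[C]_k) (M : R) j :=
  if j is j'.+1 then karcher_step g w A j' (karcher_iter g w A M j')
  else ((2 * M)%:C)%:M.

(** * The decreasing iteration and its bounds *)

Section Iteration.
Context (g : R -> R) (n k : nat) (w : 'I_n -> R) (A : 'I_n -> 'M[C]_k) (m M : R).
Hypotheses (Lg : opmonL g) (ww : weight_vector w) (pA : forall i, pdmx (A i)).
Hypotheses (m0 : 0 < m) (M0 : 0 < M).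
Hypotheses (mA : forall i, qle (m%:C)%:M (A i)) (AM : forall i, qle (A i) (M%:C)%:M).

Let mg : operator_monotone g. Proof. by case: Lg. Qed.
Let g1 : g 1 = 0. Proof. by case: Lg. Qed.
Let X_ := karcher_iter g w A M.
Let t_ j : R := j.+2%:R^-1.
Let step := karcher_step g w A.

Let t0 j : 0 < t_ j. Proof. by rewrite invr_gt0. Qed.

(** From X to Y the map loses at most (j + 1)(Y - X); the step size 1 / (j + 1) reduces this to Y -
    X, which the identity term regains. *)
Let step_qle j X Y : pdmx X -> pdmx Y -> qle X Y -> qle (step j X) (step j Y).
Proof.
move=> pX pY XY v.
have /(_ v) := karcher_map_jensen mg ww pA pX pY (t0 j) XY.
have gt := opmonL_ge_sub1V Lg (t0 j).
have c0 : 0 < (j.+1%:R : R) by [].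
rewrite /step !qf_karcher_step qfD qfZ qfB -/(t_ j) => h.
have : - g (t_ j) <= j.+1%:R.
  by move: gt; rewrite /t_ invrK [j.+2%:R]mulrS; lra.
move/(ler_wpM2r (_ : 0 <= qf Y v - qf X v)); rewrite subr_ge0 => /(_ (XY v)) h2.
have : j.+1%:R^-1 * qf (karcher_map g w A (t_ j) X) v <= j.+1%:R^-1 *
    (qf (karcher_map g w A (t_ j) Y) v + j.+1%:R * (qf Y v - qf X v)).
  by rewrite ler_wpM2l ?invr_ge0 //; lra.
move: (j.+1%:R : R) c0 => c c0.
rewrite mulrDr [c^-1 * (_ * _)]mulrA mulVf ?gt_eqF // mul1r; lra.
Qed.

Let karcher_map_lower t : 0 < t -> forall v, 0 <= qf (karcher_map g w A t (m%:C)%:M) v.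
Proof.
move=> tt v; have pm := @pd_scalar R k m m0.
rewrite qf_karcher_map sumr_ge0 // => i _; apply: mulr_ge0; first by apply/ltW; case: ww.
rewrite -(qf0 v) -(persp_self g1 pm).
apply: (persp_qle mg pm pm (pd_shift (pA i) pm (ltW tt))) => u.
rewrite qfD qfZ; have := mA i u; have := pd_qf_ge0 u pm.
by move/(mulr_ge0 (ltW tt)); lra.
Qed.

(** The lower bound persists because the monotone step sends m to something above m. For the sign,
    X_(j+1) <= X_j gives step X_(j+1) <= step X_j = X_(j+1), so the map with parameter t_j is
    nonpositive at X_(j+1); lowering t to t_(j+1) preserves this. *)
Let iter_inv j : [/\ pdmx (X_ j), qle (m%:C)%:M (X_ j) &
  forall v, qf (karcher_map g w A (t_ j) (X_ j)) v <= 0].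
Proof.
have pm := @pd_scalar R k m m0.
elim: j => [|j [pX mX GX]].
  have pX : pdmx (X_ 0) by apply: pd_scalar; rewrite mulr_gt0.
  split=> // v; rewrite /X_ /=; last first.
    rewrite qf_karcher_map -oppr_ge0 -sumrN sumr_ge0 // => i _.
    rewrite -mulrN; apply: mulr_ge0; first by apply/ltW; case: ww.
    rewrite oppr_ge0 -(qf0 v) -(persp_self g1 pX).
    apply: (persp_qle mg pX (pd_shift (pA i) pX (ltW (t0 _))) pX) => u.
    have := AM i u; rewrite /X_ /= qfD qfZ (qf_scalar M) (qf_scalar (2 * M)) /t_.
    lra.
  have [i _|n0] := pickP 'I_n; last first.
    by case: ww => _; rewrite big1 => [/esym/eqP|i]; [rewrite oner_eq0|have := n0 i].
  have := mA i v; have := AM i v; rewrite (qf_scalar M) (qf_scalar m) (qf_scalar (2 * M)).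
  have := mulr_ge0 (ltW M0) (qf1_ge0 v); lra.
have XE : X_ j.+1 = step j (X_ j) by [].
have hX : herm (X_ j.+1).
  rewrite XE /step karcher_step.unlock.
  by apply: hermD; [exact: pd_herm|apply: hermZ; exact: karcher_map_herm].
have mX' : qle (m%:C)%:M (X_ j.+1).
  apply: (@qle_trans _ _ _ (step j (m%:C)%:M)); last by rewrite XE; exact: step_qle.
  move=> v; rewrite /step qf_karcher_step lerDl mulr_ge0 ?invr_ge0 //.
  exact: karcher_map_lower (t0 j) v.
have pX' := pd_ge pm hX mX'.
have X'X : qle (X_ j.+1) (X_ j).
  by move=> v; rewrite XE /step qf_karcher_step gerDl pmulr_rle0 // invr_gt0.
split=> // v.
have st : t_ j.+1 <= t_ j by rewrite /t_ lef_pV2 ?posrE // ler_nat.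
apply: le_trans (karcher_map_qle mg ww pA pX' (ltW (t0 _)) st v) _.
have := step_qle j pX' pX X'X v; rewrite -XE /step qf_karcher_step gerDl.
by rewrite pmulr_rle0 // invr_gt0.
Qed.

Let iter_dec j : qle (X_ j.+1) (X_ j).
Proof.
move=> v; have [_ _ G] := iter_inv j.
by rewrite /X_ /= qf_karcher_step gerDl pmulr_rle0 // invr_gt0.
Qed.

Let iter_upper j : qle (X_ j) ((2 * M)%:C)%:M.
Proof. by elim: j => [|j IH] // v; apply: le_trans (iter_dec j v) (IH v). Qed.

Let lowerA X i : pdmx X -> qle X ((2 * M)%:C)%:M -> qle ((m / (2 * M))%:C *: X) (A i).
Proof.
move=> pX XM v; apply: le_trans (mA i v); have := XM v.
rewrite qfZ (qf_scalar m) qf_scalar => h.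
have c0 : 0 <= m / (2 * M) by rewrite divr_ge0 ?ltW // mulr_gt0.
have := ler_wpM2l c0 h; rewrite mulrA mulfVK // gt_eqF // mulr_gt0 //.
Qed.

(** * The limit of the iteration solves the Karcher equation *)

Section Limit.
Context (X : 'M[C]_k).
Hypotheses (pX : pdmx X) (XX : forall j, qle X (X_ j)).
Hypothesis Xlim : forall e : R, 0 < e -> exists N, forall j, (N <= j)%N ->
  qle (X_ j) ((1 + e)%:C *: X).

Let x2M : qle X ((2 * M)%:C)%:M.
Proof. exact: (qle_trans (XX 0) (iter_upper 0)). Qed.

(** Use the perspective inequality with t = 1, where g 1 = 0. Since X_N - X <= u X <= u X_N, it
    gives P(X, A_i) <= P(X_N, A_i + u X_N), and the Lipschitz bound makes the excess over P(X_N,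
    A_i) at most L u X_N. *)
Let limit_super v : qf (karcher_map g w A 0 X) v <= 0.
Proof.
have a0 : 0 < m / (2 * M) by rewrite divr_gt0 // mulr_gt0.
have [L L0 LP] := persp_lipschitz Lg a0.
set c := L * (2 * M * qf 1%:M v).
have c0 : 0 <= c by rewrite !mulr_ge0 ?qf1_ge0 // ltW.
apply/ler_addgt0Pr => e e0; rewrite add0r.
have e1 : 0 < e / (1 + c) by rewrite divr_gt0 //; lra.
have [N NP] := Xlim e1; set u := e / (1 + c) in e1 NP.
have uc : u * c <= e by rewrite /u mulrAC ler_pdivrMr ?ler_wpM2l ?(ltW e0) //; lra.
have [pN _ GN] := iter_inv N; have XN := NP N (leqnn _).
apply: le_trans (_ : qf (karcher_map g w A 0 (X_ N)) v + u * c <= _); last first.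
  have h := karcher_map_qle mg ww pA pN (lexx 0) (ltW (t0 N)) v.
  by rewrite -[e]add0r; exact: (lerD (le_trans h (GN v)) uc).
rewrite !karcher_map0 !qf_sum.
under eq_bigr do rewrite qfZ; under [X in _ <= X + _]eq_bigr do rewrite qfZ.
apply: weighted_le => // i.
have hA := pd_herm (pA i).
have XXN : pdmx (A i + 1%:C *: (X_ N - X)).
  apply: pdD => // [|y]; first by apply: hermZ; apply: hermB; exact: pd_herm.
  by rewrite qfZ qfB mul1r subr_ge0; exact: XX.
have := persp_jensen mg pX pN (pA i) ltr01 (XX N) v.
rewrite g1 scale0r addr0 => h; apply: le_trans h _.
have le1 : qle (A i + 1%:C *: (X_ N - X)) (A i + u%:C *: X_ N).
  move=> y; rewrite !qfD !qfZ qfB; have := XN y; rewrite qfZ.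
  have := ler_wpM2l (ltW e1) (XX N y); lra.
apply: le_trans (persp_qle mg pN XXN (pd_shift (pA i) pN (ltW e1)) le1 v) _.
apply: le_trans (LP _ _ _ _ pN hA (lowerA i pN (@iter_upper N)) (ltW e1) v) _.
have XM := iter_upper N v; rewrite qf_scalar in XM.
have -> : u * c = L * u * (2 * M * qf 1%:M v) by rewrite /c; ring.
have Lu : 0 <= L * u by rewrite mulr_ge0 // ltW.
by rewrite qfD qfZ lerD2l; exact: ler_wpM2l Lu _ _ XM.
Qed.

(** If the trace were -D < 0, the maps at X_j would eventually have trace at most -D/2, so step j
    would lower the trace of the iterate by (D/2) / (j + 1). The harmonic sums would then be
    bounded, because the traces are nonnegative. *)
Let limit_trace : 0 <= mtr (karcher_map g w A 0 X).
Proof.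
rewrite leNgt; apply/negP => G0.
set D := - mtr (karcher_map g w A 0 X).
have D0 : 0 < D by rewrite oppr_gt0.
have a0 : 0 < m / (2 * M) by rewrite divr_gt0 // mulr_gt0.
have [L L0 LP] := persp_lipschitz Lg a0.
set x := mtr X; have x0 : 0 <= x by rewrite /x mtrE sumr_ge0 // => a _; exact: pd_qf_ge0.
have Lx : 0 <= L * x by rewrite mulr_ge0 // ltW.
(* With this s, replacing the parameter 0 by s raises the trace of the map at X by at most D/4. *)
set s := D / 4 / (1 + L * x).
have s0 : 0 < s by rewrite !divr_gt0 //; lra.
have sx : L * s * x <= D / 4.
  have : s * (1 + L * x) = D / 4 by rewrite mulfVK // gt_eqF //; lra.
  lra.
(* With this e, the correction -g(s) ((1 + e) X - X_j) has trace at most D/4. *)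
set e := D / 4 / (1 + `|g s| * x).
have gx0 : 0 <= `|g s| * x by rewrite mulr_ge0.
have e0 : 0 < e by rewrite !divr_gt0 //; lra.
have ex : `|g s| * (e * x) <= D / 4.
  have : e * (1 + `|g s| * x) = D / 4 by rewrite mulfVK // gt_eqF //; lra.
  lra.
have [N1 N1P] := Xlim e0.
have [N2 N2P] : exists N, forall j, (N <= j)%N -> t_ j <= s.
  exists (Num.Def.truncn s^-1) => j Nj; rewrite /t_ invf_ple ?posrE //.
  have /truncn_itv/andP[_ h] : 0 <= s^-1 by rewrite invr_ge0 ltW.
  by apply: le_trans (ltW h) _; rewrite ler_nat ltnS (leq_trans Nj).
have pY : pdmx ((1 + e)%:C *: X) by apply: pdZ => //; lra.
have GX' : mtr (karcher_map g w A s X) <= - D + D / 4.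
  rewrite /D opprK; apply: le_trans (_ : mtr (karcher_map g w A 0 X + (L * s)%:C *: X) <= _).
    apply: mtr_qle => v; rewrite qfD qfZ karcher_map0 qf_sum qf_karcher_map.
    under [X in _ <= X + _]eq_bigr do rewrite qfZ.
    apply: weighted_le => // i; rewrite -qfZ -qfD.
    exact: (LP _ _ _ _ pX (pd_herm (pA i)) (lowerA i pX x2M) (ltW s0)).
  by rewrite mtrD mtrZ lerD2l.
have trG j : (maxn N1 N2 <= j)%N -> mtr (karcher_map g w A (t_ j) (X_ j)) <= - (D / 2).
  rewrite geq_max => /andP[j1 j2]; have [pj _ _] := iter_inv j.
  have XY := N1P j j1.
  apply: le_trans (mtr_qle (karcher_map_qle mg ww pA pj (ltW (t0 j)) (N2P j j2))) _.
  apply: le_trans (mtr_qle (karcher_map_jensen mg ww pA pj pY s0 XY)) _.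
  rewrite mtrD mtrZ mtrD mtrN mtrZ.
  (* By homogeneity, since A_i + s (1 + e) X <= (1 + e) (A_i + s X). *)
  have GY : qle (karcher_map g w A s ((1 + e)%:C *: X))
      ((1 + e)%:C *: karcher_map g w A s X).
    move=> v; rewrite qfZ !qf_karcher_map mulr_sumr; apply: ler_sum => i _.
    rewrite mulrCA; apply: ler_wpM2l; first by apply/ltW; case: ww.
    have e10 : 0 < 1 + e by lra.
    rewrite -qfZ -(persp_scale _ _ e10 (pd_herm pX)).
    have p1 := pd_shift (pA i) pY (ltW s0).
    have p2 : pdmx ((1 + e)%:C *: (A i + s%:C *: X)).
      exact: (pdZ e10 (pd_shift (pA i) pX (ltW s0))).
    apply: (persp_qle mg pY p1 p2) => y; rewrite !(qfD, qfZ).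
    have := mulr_ge0 (ltW e0) (pd_qf_ge0 y (pA i)); lra.
  have := mtr_qle GY; rewrite mtrZ => GY'.
  have xj : mtr X <= mtr (X_ j) by exact: mtr_qle.
  have xj2 : mtr (X_ j) <= (1 + e) * mtr X by rewrite -mtrZ; exact: mtr_qle.
  have : - g s * ((1 + e) * mtr X - mtr (X_ j)) <= `|g s| * (e * x).
    apply: le_trans (_ : `|g s| * ((1 + e) * mtr X - mtr (X_ j)) <= _).
      by rewrite ler_wpM2r ?subr_ge0 // -normrN ler_norm.
    by rewrite ler_wpM2l // /x; lra.
  have : (1 + e) * mtr (karcher_map g w A s X) <= - D + D / 4.
    apply: le_trans (_ : (1 + e) * (- D + D / 4) <= _).
      by rewrite ler_wpM2l //; lra.
    have := mulr_gt0 e0 D0; lra.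
  lra.
set N := maxn N1 N2 in trG.
have dec p : mtr (X_ (N + p)%N) + D / 2 * (series harmonic (N + p)%N - series harmonic N)
    <= mtr (X_ N).
  elim: p => [|p IH]; first by rewrite addn0 subrr mulr0 addr0.
  rewrite addnS; apply: le_trans IH.
  rewrite seriesSr /harmonic /= /X_ /= karcher_step.unlock mtrD mtrZ.
  have := trG (N + p)%N (leq_addr _ _); rewrite -/X_ /t_ => h.
  have : (N + p).+1%:R^-1 * mtr (karcher_map g w A ((N + p).+2%:R^-1) (X_ (N + p)%N))
     <= (N + p).+1%:R^-1 * - (D / 2) by rewrite ler_wpM2l // invr_ge0.
  have aux (r y d z z' a : R) : r * y <= r * - d ->
    a + r * y + d * (z + r - z') <= a + d * (z - z') by lra.
  exact: aux.
apply: (@dvg_harmonic R); apply: nondecreasing_is_cvgn.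
  by apply/nondecreasing_seqP => j; rewrite seriesSr lerDl /harmonic invr_ge0.
exists (series harmonic N + mtr (X_ N) / (D / 2)) => _ [j _ <-].
have nd : nondecreasing_seq (series (@harmonic R)).
  by apply/nondecreasing_seqP => i; rewrite seriesSr lerDl /harmonic invr_ge0.
apply: le_trans (nd _ _ (leq_addl N j)) _.
rewrite -lerBlDl ler_pdivlMr ?divr_gt0 // mulrC.
have := dec j; have : 0 <= mtr (X_ (N + j)%N); last lra.
by rewrite mtrE sumr_ge0 // => a _; have [pj _ _] := iter_inv (N + j)%N; exact: pd_qf_ge0.
Qed.

(** The negated sum is positive semidefinite with nonpositive trace; being bounded above by its
    trace, it vanishes. *)
Lemma karcher_limit_solution : karcher_solution g w A X.
Proof.
apply/karcher_solutionP; split=> //; rewrite -karcher_map0.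
set G := karcher_map _ _ _ _ _.
have hG : herm G by exact: karcher_map_herm.
apply: herm_qf0 => // v; apply/eqP; rewrite eq_le limit_super /=.
have G0 u : 0 <= qf (- G) u by rewrite qfN oppr_ge0 limit_super.
have := psd_le_mtr (hermN hG) G0 v; rewrite qfN qf_scalar mtrN => h.
rewrite -oppr_le0; apply: le_trans h _.
by apply: mulr_le0_ge0; [rewrite oppr_le0; exact: limit_trace|exact: qf1_ge0].
Qed.

End Limit.

Lemma karcher_solution_exists : exists X, karcher_solution g w A X.
Proof.
have hX j : herm (X_ j) by have [pX _ _] := iter_inv j; exact: pd_herm.
have mX j : qle (m%:C)%:M (X_ j) by have [_ h _] := iter_inv j.
have [X [hXX mXX XX Xe]] := loewner_monotone_limit hX iter_dec mX.
have pX := pd_ge (pd_scalar k m0) hXX mXX.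
exists X; apply: karcher_limit_solution => // e e0.
(* Since X >= m, the additive error e m is at most the multiplicative error e X. *)
have [N NP] := Xe (e * m) (mulr_gt0 e0 m0); exists N => j Nj v.
have := NP j Nj v; have := ler_wpM2l (ltW e0) (mXX v).
rewrite qfZ qfD (qf_scalar m) (qf_scalar (e * m)); lra.
Qed.

End Iteration.

(** Existence rules out the default value of [xget]. *)
Lemma sigma_mean_solution g n k (w : 'I_n -> R) (A : 'I_n -> 'M[C]_k) m M :
  opmonL g -> weight_vector w -> (forall i, pdmx (A i)) -> 0 < m -> 0 < M ->
  (forall i, qle (m%:C)%:M (A i)) -> (forall i, qle (A i) (M%:C)%:M) ->
  karcher_solution g w A (sigma_mean g w A).
Proof.
move=> Lg ww pA m0 M0 mA AM.
have [X SX] := karcher_solution_exists Lg ww pA m0 M0 mA AM.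
exact: (@xgetPex _ 1%:M [set X | karcher_solution g w A X] (ex_intro _ X SX)).
Qed.

End KarcherEquation.

(** * Unital positive maps *)

Section PositiveMaps.
Context {R : realType}.
Implicit Types (k n : nat) (g : R -> R).
Local Notation C := R[i].

Lemma positive_map_qle k l (Psi : {linear 'M[C]_k -> 'M[C]_l}) A B :
  positive_map Psi -> herm A -> herm B -> qle A B -> qle (Psi A) (Psi B).
Proof.
move=> pos hA hB AB.
have /pos/psdmxP[_ h] : psdmx (B - A).
  by apply/psdmxP; split=> [|v]; [exact: hermB|rewrite qfB subr_ge0].
by move=> v; have := h v; rewrite linearB qfB subr_ge0.
Qed.

Lemma unital_map_scalar k l (Psi : {linear 'M[C]_k -> 'M[C]_l}) (c : R) :
  unital_map Psi -> Psi (c%:C)%:M = (c%:C)%:M.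
Proof. by move=> u1; rewrite -scalemx1 linearZ /= u1 scalemx1. Qed.

Lemma positive_map_pd k l (Psi : {linear 'M[C]_k -> 'M[C]_l}) A :
  positive_map Psi -> unital_map Psi -> pdmx A -> pdmx (Psi A).
Proof.
move=> pos u1 pA; have [c c0 cA] := pd_lower pA.
have hA := pd_herm pA.
have /pos/psdmxP[hPA _] : psdmx A.
  by apply/psdmxP; split=> // v; exact: pd_qf_ge0.
apply: (pd_ge (pd_scalar l c0) hPA); rewrite -(unital_map_scalar _ u1).
exact: (positive_map_qle pos (pd_herm (pd_scalar k c0)) hA cA).
Qed.

(* The isometry V stacks the square roots of the positive matrices Psi (P_j),
   where P_j are the spectral projections of A. *)
Lemma choi_davis g k l (Psi : {linear 'M[C]_k -> 'M[C]_l}) A :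
  operator_monotone g -> positive_map Psi -> unital_map Psi -> pdmx A ->
  qle (Psi (fcalc g A)) (fcalc g (Psi A)).
Proof.
move=> mg pos u1 pA; have hA := pd_herm pA.
set U := eigvecs A.
pose P j := (row j U)^t* *m row j U.
have psdP j : psdmx (P j).
  apply/psdmxP; have PE : P j = (row j U)^t* *m 1%:M *m (row j U)^t*^t*.
    by rewrite trmxCK mulmx1.
  split=> [|v]; rewrite PE; first by apply: herm_cong; exact: herm1.
  by rewrite qf_cong; exact: qf1_ge0.
(* The rank-one projections are indexed by eigenvectors, with repeated eigenvalues kept apart, so
   one family serves every f. *)
have fE f : fcalc f A = \sum_j (f (eig A j))%:C *: P j.
  rewrite fcalcE -/U; apply/matrixP => a b; rewrite mxE summxE; apply: eq_bigr => j _.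
  by rewrite /ediag mul_mx_diag !mxE big_ord1 !mxE mulrAC mulrC.
pose E j := Psi (P j).
have hE j : herm (E j) by have /pos/psdmxP[] := psdP j.
have E0 j v : 0 <= qf (E j) v by have /pos/psdmxP[_ ] := psdP j; exact.
have EE j : msqrt (E j) *m msqrt (E j) = E j by exact: psd_sqrt.
pose V : 'M[C]_(l, k * l) := \matrix_(a, q) (mxvec (\matrix_(j, c) msqrt (E j) a c)) 0 q.
(* The columns of V are indexed by pairs (j, c) flattened through [mxvec]; [D d] repeats each d_j
   for the l values of c. *)
pose D (d : 'I_k -> R) (q : 'I_(k * l)) : R :=
  complex.Re (mxvec (\matrix_(j < k, c < l) (d j)%:C : 'M[C]_(k, l)) 0 q).
have VDV d : V *m ediag (D d) *m V^t* = \sum_j (d j)%:C *: E j.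
  apply/matrixP => a b; rewrite mxE summxE (reindex _ (curry_mxvec_bij k l)) /=.
  rewrite (eq_bigr (fun p : 'I_k * 'I_l =>
      (d p.1)%:C * (msqrt (E p.1) a p.2 * msqrt (E p.1) p.2 b))); last first.
    case=> j c _ /=; rewrite /ediag mul_mx_diag !mxE !mxvecE !mxE /D mxvecE mxE /=.
    by rewrite -(hermE b c (msqrt_herm _)) mulrAC mulrC.
  rewrite -(pair_bigA _ (fun j c =>
      (d j)%:C * (msqrt (E j) a c * msqrt (E j) c b))) /=; apply: eq_bigr => j _.
  by rewrite -mulr_sumr mxE -[in RHS]EE mxE.
have PsiE f : Psi (fcalc f A) = V *m ediag (D (fun j => f (eig A j))) *m V^t*.
  by rewrite VDV fE linear_sum; apply: eq_bigr => j _; rewrite linearZ.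
have Dcomp d f : ediag (D (fun j => f (d j))) = ediag (fun q => f (D d q)).
  congr diag_mx; apply/rowP => q; rewrite !mxE; case/mxvec_indexP: q => j c.
  by rewrite /D !mxvecE !mxE.
have V1 : V *m V^t* = 1%:M.
  have := PsiE (fun=> 1); rewrite fcalc_cst u1 => ->.
  rewrite (Dcomp (eig A) (fun=> 1)) ediag_cst mulmx1 //.
have pW : pdmx (ediag (D (eig A))).
  apply: ediag_pd => q; case/mxvec_indexP: q => j c.
  by rewrite /D mxvecE mxE /= eig_gt0.
have := opmon_compress mg V1 pW.
have PA : Psi A = V *m ediag (D (eig A)) *m V^t* by rewrite -[in LHS](fcalc_id hA) PsiE.
rewrite -PA => /(_ (positive_map_pd pos u1 pA)).
by rewrite fcalc_ediag PsiE (Dcomp (eig A) g).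
Qed.

End PositiveMaps.

(** * Kantorovich bounds *)

Section KantorovichBound.
Context {R : realType}.
Implicit Types (k n : nat) (g : R -> R).
Local Notation C := R[i].

(** The bound g x <= x - 1 gives P(X, A_i) <= A_i - X; then average. *)
Lemma karcher_le_arithmetic g n k (w : 'I_n -> R) (A : 'I_n -> 'M[C]_k) X :
  opmonL g -> weight_vector w -> (forall i, pdmx (A i)) ->
  karcher_solution g w A X -> qle X (\sum_i (w i)%:C *: A i).
Proof.
move=> Lg ww pA /karcher_solutionP[pX eX] v.
have : qf (\sum_i (w i)%:C *: persp g X (A i)) v <=
    \sum_i w i * qf (A i) v + - qf X v.
  rewrite qf_sum; under eq_bigr do rewrite qfZ.
  apply: weighted_le => // i; rewrite -qfN -qfD.
  have -> : A i + - X = msqrt X *m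
      fcalc (fun x => x + (- 1)) (mrsqrt X *m A i *m mrsqrt X) *m msqrt X.
    have pZ := mrsqrt_pd pX (pA i).
    rewrite (fcalcD (fun x => x) (fun=> -1)) fcalc_cst (fcalc_id (pd_herm pZ)).
    have -> : ((-1)%:C)%:M = - 1%:M :> 'M[C]_k by rewrite rmorphN raddfN.
    rewrite mulmxBr mulmxBl msqrt_self // !mulmxA msqrt_mrsqrt // mul1mx -mulmxA.
    by rewrite mrsqrt_msqrt // mulmx1.
  rewrite perspE !msqrt_cong; apply: qle_cong; apply: fcalc_qle => j.
  apply: opmonL_le_sub1 => //; apply: eig_gt0; exact: mrsqrt_pd.
rewrite eX qf0 qf_sum subr_ge0 => h; apply: le_trans h _.
by apply: ler_sum => i _; rewrite qfZ.
Qed.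

(** With Z_i = X^-1/2 A_i X^-1/2, averaging 1 - Z_i^-1 <= g(Z_i) gives 1 <= sum_i w_i Z_i^-1.
    Congruence by X^-1/2 turns Z_i^-1 into A_i^-1. *)
Lemma harmonic_le_karcher g n k (w : 'I_n -> R) (A : 'I_n -> 'M[C]_k) X :
  opmonL g -> weight_vector w -> (forall i, pdmx (A i)) ->
  karcher_solution g w A X -> qle (minv X) (\sum_i (w i)%:C *: minv (A i)).
Proof.
move=> Lg ww pA [pX eX] v; have [w0 w1] := ww.
have E i : fun_mx g (invsqrt_mx X *m A i *m invsqrt_mx X) =
    fcalc g (mrsqrt X *m A i *m mrsqrt X).
  by rewrite fcalc.unlock /invsqrt_mx /mrsqrt fcalc.unlock.
have pZ i := mrsqrt_pd pX (pA i).
have key u : qf 1%:M u <=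
    \sum_i w i * qf (minv (mrsqrt X *m A i *m mrsqrt X)) u.
  have : \sum_i w i * (- qf (minv (mrsqrt X *m A i *m mrsqrt X)) u) <=
      \sum_i w i * qf (fcalc g (mrsqrt X *m A i *m mrsqrt X)) u + - qf 1%:M u.
    apply: weighted_le => // i; rewrite -lerBlDr opprK.
    have := @fcalc_qle _ _ (fun x => 1 + - x^-1) g (mrsqrt X *m A i *m mrsqrt X).
    move=> /(_ (fun j => opmonL_ge_sub1V Lg (eig_gt0 j (pZ i)))) /(_ u).
    by rewrite fcalcD fcalc_cst fcalcN qfD qfN addrC.
  have -> : \sum_i w i * qf (fcalc g (mrsqrt X *m A i *m mrsqrt X)) u = 0.
    rewrite -[RHS](qf0 u) -eX qf_sum; apply: eq_bigr => i _.
    by rewrite qfZ E.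
  under eq_bigr do rewrite mulrN.
  by rewrite sumrN add0r lerN2.
have minvZ i : mrsqrt X *m minv (mrsqrt X *m A i *m mrsqrt X) *m mrsqrt X = minv (A i).
  have -> : minv (mrsqrt X *m A i *m mrsqrt X) = msqrt X *m minv (A i) *m msqrt X.
    apply: minvE => //; rewrite !mulmxA -[_ *m mrsqrt X *m msqrt X]mulmxA.
    rewrite mrsqrt_msqrt // mulmx1 -[_ *m A i *m minv _]mulmxA mulmx_minv // mulmx1.
    exact: mrsqrt_msqrt.
  rewrite !mulmxA mrsqrt_msqrt // mul1mx -mulmxA msqrt_mrsqrt //.
  by rewrite mulmx1.
have -> : minv X = mrsqrt X *m 1%:M *m mrsqrt X by rewrite mulmx1 mrsqrtK.
rewrite mrsqrt_cong qf_cong.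
apply: le_trans (key _) _; rewrite qf_sum; apply: ler_sum => i _.
by rewrite qfZ -(minvZ i) [X in _ <= _ * qf X _]mrsqrt_cong qf_cong.
Qed.

(** On the spectrum this is (x - m)(M - x) >= 0 divided by x. *)
Lemma kantorovich_matrix k (A : 'M[C]_k) (m M : R) : pdmx A -> 0 < m -> m < M ->
  qle (m%:C)%:M A -> qle A (M%:C)%:M ->
  qle (A + (m * M)%:C *: minv A) ((m + M)%:C)%:M.
Proof.
move=> pA m0 mM mA AM; have hA := pd_herm pA.
rewrite -(fcalc_cst _ A) -{1}(fcalc_id hA) -fcalcZ -fcalcD; apply: fcalc_qle => j.
have a0 := eig_gt0 j pA; have ma := eig_ge j hA mA; have aM := eig_le j hA AM.
rewrite -(ler_pM2r a0) mulrDl divfK ?gt_eqF //.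
have : 0 <= (eig A j - m) * (M - eig A j) by rewrite mulr_ge0 // subr_ge0.
lra.
Qed.

(** Since K(M/m, 2) = (m + M)^2 / (4 m M), this is the arithmetic-geometric inequality on the
    spectrum; the difference is a square over a positive number. *)
Lemma kantorovich_amgm k (X : 'M[C]_k) (m M : R) : pdmx X -> 0 < m -> m < M ->
  qle ((m + M)%:C)%:M ((m * M)%:C *: minv X + (kantorovich (M / m))%:C *: X).
Proof.
move=> pX m0 mM; have hX := pd_herm pX; have M0 : 0 < M by exact: lt_trans mM.
rewrite -(fcalc_cst _ X) -{3}(fcalc_id hX) -!fcalcZ -fcalcD; apply: fcalc_qle => j.
have x0 := eig_gt0 j pX; set x := eig X j in x0 *.
rewrite -subr_ge0 /kantorovich.
have -> : m * M * x^-1 + (M / m + 1) ^+ 2 / (4 * (M / m)) * x - (m + M) =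
    ((M + m) * x - 2 * (m * M)) ^+ 2 / (4 * (m * M) * x).
  by field; rewrite !gt_eqF.
by rewrite divr_ge0 ?sqr_ge0 // ltW // !mulr_gt0.
Qed.

Lemma positive_map_subsolution g n k l (w : 'I_n -> R) (A : 'I_n -> 'M[C]_k)
    (Phi : {linear 'M[C]_k -> 'M[C]_l}) X v :
  operator_monotone g -> weight_vector w -> (forall i, pdmx (A i)) ->
  positive_map Phi -> unital_map Phi -> karcher_solution g w A X ->
  0 <= qf (\sum_i (w i)%:C *: persp g (Phi X) (Phi (A i))) v.
Proof.
move=> mg ww pA pos u1 [pX eX].
have pPX : pdmx (Phi X) by exact: positive_map_pd.
set S := mrsqrt (Phi X); set T := msqrt X.
pose Psi : {linear 'M[C]_k -> 'M[C]_l} :=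
  (mulmxr S \o mulmx S) \o (Phi \o (mulmxr T \o mulmx T)).
have PsiE Z : Psi Z = S *m Phi (T *m Z *m T) *m S by [].
have posPsi : positive_map Psi.
  move=> Z pZ; have /pos pPZ : psdmx (T *m Z *m T).
    move/psdmxP: pZ => [hZ Z0]; apply/psdmxP; rewrite /T msqrt_cong.
    by split=> [|u]; [exact: herm_cong|rewrite qf_cong].
  move/psdmxP: pPZ => [hZ Z0]; apply/psdmxP; rewrite PsiE /S mrsqrt_cong.
  by split=> [|u]; [exact: herm_cong|rewrite qf_cong].
have uPsi : unital_map Psi.
  by rewrite /unital_map PsiE msqrt_self // mrsqrt_self.
have cd i : qle (Psi (fcalc g (mrsqrt X *m A i *m mrsqrt X)))
    (fcalc g (S *m Phi (A i) *m S)).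
  have := choi_davis mg posPsi uPsi (mrsqrt_pd pX (pA i)).
  rewrite PsiE [Psi (mrsqrt _ *m _ *m _)]PsiE.
  suff -> : T *m (mrsqrt X *m A i *m mrsqrt X) *m T = A i by [].
  by rewrite !mulmxA msqrt_mrsqrt // mul1mx -mulmxA mrsqrt_msqrt // mulmx1.
(* [Psi] of the Karcher sum is 0; it bounds the sum for [Phi] from below term by term through
   [cd]. *)
have : qf (Psi (\sum_i (w i)%:C *: fcalc g (mrsqrt X *m A i *m mrsqrt X)))
    (v *m msqrt (Phi X)) = 0.
  move: eX; rewrite /invsqrt_mx => eX.
  rewrite (_ : \sum_i _ = 0) ?linear0 ?qf0 // -[RHS]eX.
  by apply: eq_bigr => i _; rewrite fcalc.unlock /mrsqrt fcalc.unlock.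
rewrite linear_sum qf_sum => <-; rewrite qf_sum; apply: ler_sum => i _.
rewrite linearZ !qfZ ler_wpM2l //; first by apply/ltW; case: ww.
by rewrite perspE msqrt_cong qf_cong; exact: cd.
Qed.

End KantorovichBound.

Theorem theorem3p1 (R : realType) (n k l : nat) (g : R -> R)
    (A : 'I_n -> 'M[R[i]]_k) (m M : R) (w : 'I_n -> R)
    (Phi : {linear 'M[R[i]]_k -> 'M[R[i]]_l}) :
  opmonL g ->
  0 < m -> m < M ->
  (forall i, pdmx (A i)) ->
  (forall i, (m%:C)%:M <=L A i /\ A i <=L (M%:C)%:M) ->
  weight_vector w ->
  positive_map Phi -> unital_map Phi ->
  Phi (sigma_mean g w A) <=L sigma_mean g w (fun i => Phi (A i)) /\
  sigma_mean g w (fun i => Phi (A i))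
    <=L (kantorovich (M / m))%:C *: Phi (sigma_mean g w A).
Proof.
move=> Lg m0 mM pA bA ww pos u1; have M0 := lt_trans m0 mM.
have [mg _ _] := Lg.
have mA i : qle (m%:C)%:M (A i) by exact: loewner_qle (bA i).1.
have AM i : qle (A i) (M%:C)%:M by exact: loewner_qle (bA i).2.
have hA i := pd_herm (pA i).
have pPA i : pdmx (Phi (A i)) by exact: positive_map_pd.
have mPA i : qle (m%:C)%:M (Phi (A i)).
  rewrite -(unital_map_scalar _ u1).
  exact: (positive_map_qle pos (pd_herm (pd_scalar k m0)) (hA i) (mA i)).
have PAM i : qle (Phi (A i)) (M%:C)%:M.
  rewrite -(unital_map_scalar _ u1).
  exact: (positive_map_qle pos (hA i) (pd_herm (pd_scalar k M0)) (AM i)).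
have SX := sigma_mean_solution Lg ww pA m0 M0 mA AM.
have SY := sigma_mean_solution Lg ww pPA m0 M0 mPA PAM.
set X := sigma_mean g w A in SX *; set Y := sigma_mean g w _ in SY *.
have [pX eX] := (karcher_solutionP _ _ _ _).1 SX.
have [pY eY] := (karcher_solutionP _ _ _ _).1 SY.
have pPX : pdmx (Phi X) by exact: positive_map_pd.
split.
  apply/loewnerP; [exact: pd_herm|exact: pd_herm|].
  apply: (karcher_comparison Lg ww pPA pY pPX) => v; last by rewrite eY qf0.
  exact: positive_map_subsolution.
apply/loewnerP; [exact: pd_herm|by apply: hermZ; exact: pd_herm|].
apply: (qle_trans (karcher_le_arithmetic Lg ww pPA SY)).
(* By linearity and monotonicity of [Phi] it remains to bound sum_i w_i A_i by K X before [Phi] is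
   applied. *)
have -> : \sum_i (w i)%:C *: Phi (A i) = Phi (\sum_i (w i)%:C *: A i).
  by rewrite linear_sum; apply: eq_bigr => i _; rewrite linearZ.
have -> : (kantorovich (M / m))%:C *: Phi X = Phi ((kantorovich (M / m))%:C *: X).
  by rewrite linearZ.
apply: (positive_map_qle pos).
- by apply: herm_sum => i; apply: hermZ.
- by apply: hermZ; exact: pd_herm.
move=> v.
have h1 : \sum_i w i * qf (A i) v <=
    \sum_i w i * (- (m * M) * qf (minv (A i)) v) + (m + M) * qf 1%:M v.
  apply: weighted_le => // i.
  have := kantorovich_matrix (pA i) m0 mM (mA i) (AM i) v.
  rewrite qfD qfZ qf_scalar; lra.
have h2 := harmonic_le_karcher Lg ww pA SX v.
have h3 := kantorovich_amgm pX m0 mM v.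
rewrite qf_scalar qfD !qfZ in h3; rewrite qf_sum in h2.
rewrite qf_sum qfZ; under eq_bigr do rewrite qfZ.
apply: le_trans h1 _.
have -> : \sum_i w i * (- (m * M) * qf (minv (A i)) v) =
    - (m * M) * \sum_i qf ((w i)%:C *: minv (A i)) v.
  by rewrite mulr_sumr; apply: eq_bigr => i _; rewrite qfZ mulrCA.
have mM0 : 0 <= m * M by rewrite mulr_ge0 ?ltW.
have := ler_wpM2l mM0 h2; lra.
Qed.
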